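(* Let $R=k[x_1,\ldots,x_n]$ ($n\ge 3$) be a polynomial ring over an infinite field $k$ and let $\Theta$ be a $2\times 4$ matrix of rank $2$ with entries in $R$ whose first and second rows consist of homogeneous polynomials of degrees $d_1$ and $d_2$, respectively, where $0\le d_1\le d_2$ and the greatest common divisor of the entries of each row is $1$. Let $e=\operatorname{indeg}(\operatorname{Syz}(\Theta))$ and let $\nu\in\operatorname{Syz}(\Theta)$ be a minimal homogeneous generator of degree $e\ge 1$. If $\Theta$ is not free, then $$\operatorname{Bour}(\Theta)=\begin{cases}(e-d)(e+e_0(\mathcal Q))+\mathfrak q_\Theta+\ell_{\mathcal Q}+e_1(\mathcal Q), & \text{if } e_0(\mathcal Q)\neq 0,\\ e(e-d)+\mathfrak q_\Theta-e_1(\mathcal Q), & \text{if } e_0(\mathcal Q)=0,\end{cases}$$ where $d=d_1+d_2$, $\mathfrak q_\Theta=d_1^2+d_2^2+d_1d_2$ and $\ell_{\mathcal Q}=\tfrac12\bigl(e_0(\mathcal Q)^2+e_0(\mathcal Q)\bigr)$. Furthermore, when $\dim(\mathcal Q)\le n-3$, one has $\operatorname{Bour}(\Theta)=\mathfrak q_\Theta$ and the minimal free graded resolution of $\mathcal Q$ is a Buchsbaum--Rim complex.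
   Context: The matrix defines a graded map $\Theta:R^4\to R(d_1)\oplus R(d_2)$; put $\operatorname{Syz}(\Theta)=\ker\Theta\subseteq R^4$ (a reflexive graded module of rank 2) and $\mathcal Q=\operatorname{coker}\Theta$. $\Theta$ is free if $\operatorname{Syz}(\Theta)$ is a free $R$-module. For a graded module $E$, $\operatorname{indeg}(E)=\min\{i: E_i\ne 0\}$. Hilbert coefficients: the Hilbert polynomial of $\mathcal Q$ is written $$\mathrm{HP}_{\mathcal Q}(t)=\frac{e_0(\mathcal Q)}{(n-2)!}t^{n-2}+\frac{(n-1)e_0(\mathcal Q)-2e_1(\mathcal Q)}{2(n-3)!}t^{n-3}+(\text{lower order terms}),$$ except that when $e_0(\mathcal Q)=0$ the sign of $e_1(\mathcal Q)$ is changed so that it is a non-negative leading coefficient: $\mathrm{HP}_{\mathcal Q}(t)=\frac{e_1(\mathcal Q)}{(n-3)!}t^{n-3}+\cdots$. Bourbaki degree: with $e=\operatorname{indeg}(\operatorname{Syz}(\Theta))$, a nonzero $\nu\in\operatorname{Syz}(\Theta)$ of degree $e$ gives an injection $R(-e)\hookrightarrow\operatorname{Syz}(\Theta)$ whose cokernel is torsion-free of rank one, and (if $\Theta$ is not free) isomorphic by a degree-zero graded isomorphism to $I_\nu(s)$ for some integer $s$ and some homogeneous proper ideal $I_\nu\subset R$ of codimension two (the Bourbaki ideal). $\operatorname{Bour}(\Theta)=\deg(R/I_\nu)$, which is independent of the choice of $\nu$ (and $\operatorname{Bour}(\Theta)=0$ if $\Theta$ is free). Buchsbaum--Rim complex (with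 $\Delta_{ij}=f_ig_j-f_jg_i$ the $2$-minors of $\Theta$, where $(f_i)$, $(g_i)$ are the rows): $$0\to R(-2d_1-d_2)\oplus R(-d_1-2d_2)\to R^4(-d_1-d_2)\xrightarrow{\psi}R^4\xrightarrow{\Theta}R(d_1)\oplus R(d_2)\to\mathcal Q\to0,$$ where $\psi$ is the skew-symmetric matrix built from the $\Delta_{ij}$ and the left-most map is, up to signs, the transpose of $\Theta$. *)

(* Defs.v *)
From HB Require Import structures.
From mathcomp Require Export all_boot all_order all_algebra.
From mathcomp Require Export mpoly.

Set Implicit Arguments.
Unset Strict Implicit.
Unset Printing Implicit Defensive.

Import Order.TTheory GRing.Theory Num.Theory.
Local Open Scope ring_scope.

Definition infinite_field (k : fieldType) : Prop :=
  forall s : seq k, exists x, x \notin s.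

(* The elements of the graded piece R_t, where R_t = 0 for t < 0. *)
Definition homogz (k : fieldType) (n : nat) (t : int) (p : {mpoly k[n]}) : Prop :=
  match t with
  | Posz d => p \is d.-homog
  | Negz _ => p = 0
  end.

(* A tuple of shifts a : 'I_r -> int stands for the graded free module
   F = (+)_i R(- a i), whose elements are the columns of size r; this is the
   graded piece F_t. *)
Definition homog_vec (k : fieldType) (n r : nat) (a : 'I_r -> int) (t : int)
    (v : 'cV[{mpoly k[n]}]_r) : Prop :=
  forall i, homogz (t - a i) (v i 0).

(* The matrix A, acting on columns, is a degree-zero graded map
   (+)_j R(- b j) -> (+)_i R(- a i). *)
Definition graded_mx (k : fieldType) (n p q : nat)
    (a : 'I_p -> int) (b : 'I_q -> int) (A : 'M[{mpoly k[n]}]_(p, q)) : Prop :=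
  forall i j, homogz (b j - a i) (A i j).

(* A finitely generated graded module F / N, with F = (+)_i R(- gshift i) and
   N the submodule of the columns satisfying grel. *)
Record gmod (k : fieldType) (n : nat) := GMod {
  grank : nat;
  gshift : 'I_grank -> int;
  grel : 'cV[{mpoly k[n]}]_grank -> Prop
}.
Arguments gshift {k n} M : rename.
Arguments grel {k n} M : rename.

Definition gcoker (k : fieldType) (n p q : nat) (a : 'I_p -> int)
    (A : 'M[{mpoly k[n]}]_(p, q)) : gmod k n :=
  GMod a (fun w => exists v, w = A *m v).

Definition gquot (k : fieldType) (n : nat) (I : {pred {mpoly k[n]}}) : gmod k n :=
  GMod (fun _ : 'I_1 => 0) (fun w => w 0 0 \in I).

(* dim_k M_t = m: some m elements of F_t induce a k-basis of F_t / N_t. *)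
Definition hilbert_fun (k : fieldType) (n : nat) (M : gmod k n) (t : int)
    (m : nat) : Prop :=
  exists b : 'I_m -> 'cV[{mpoly k[n]}]_(grank M),
    (forall i, homog_vec (gshift M) t (b i)) /\
    (forall v, homog_vec (gshift M) t v ->
       exists! c : 'rV[k]_m, grel M (v - \sum_i (c 0 i)%:MP *: b i)).

Definition hilbert_poly (k : fieldType) (n : nat) (M : gmod k n)
    (P : {poly rat}) : Prop :=
  exists t0 : nat, forall t : nat, (t0 <= t)%N ->
    exists2 m, hilbert_fun M t m & P.[t%:R] = m%:R.

(* P is the Hilbert polynomial of a graded module of dimension at most n - 1,
   and e0, e1 are the coefficients in
     P = e0 / (n-2)! t^(n-2)
         + ((n-1) e0 - 2 e1) / (2 (n-3)!) t^(n-3) + ...,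
   where, if e0 = 0, the sign of e1 is changed. *)
Definition hilbert_coefs (n : nat) (P : {poly rat}) (e0 e1 : rat) : Prop :=
  P`_(n - 2) = e0 / (n - 2)`!%:R /\
  P`_(n - 3) = if e0 == 0 then e1 / (n - 3)`!%:R
               else ((n - 1)%:R * e0 - 2 * e1) / (2 * (n - 3)`!%:R).

Definition gann (k : fieldType) (n : nat) (M : gmod k n) (x : {mpoly k[n]}) : Prop :=
  forall v : 'cV_(grank M), grel M (x *: v).

(* P_0 < P_1 < ... < P_m are primes containing the annihilator of M;
   idealr_closed includes properness. *)
Definition prime_chain (k : fieldType) (n : nat) (M : gmod k n) (m : nat)
    (P : nat -> {pred {mpoly k[n]}}) : Prop :=
  (forall i, (i <= m)%N ->
     [/\ idealr_closed (P i), prime_idealr_closed (P i)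
       & forall x, gann M x -> x \in P i]) /\
  (forall i, (i < m)%N ->
     {subset P i <= P i.+1} /\ exists2 x, x \in P i.+1 & x \notin P i).

Definition krull_dim_le (k : fieldType) (n : nat) (M : gmod k n) (d : nat) : Prop :=
  forall m P, prime_chain M m P -> (m <= d)%N.

Definition krull_dim (k : fieldType) (n : nat) (M : gmod k n) (d : nat) : Prop :=
  (exists P, prime_chain M d P) /\ krull_dim_le M d.

(* The degree (multiplicity) of a graded module of positive dimension D + 1:
   D! times the coefficient of t^D in its Hilbert polynomial. *)
Definition gdegree (k : fieldType) (n : nat) (M : gmod k n) (b : rat) : Prop :=
  exists D P, [/\ krull_dim M D.+1, hilbert_poly M P & b = D`!%:R * P`_D].

Definition row_deg (d1 d2 : nat) (i : 'I_2) : nat := if i == 0 then d1 else d2.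

(* Twists of the target R(d1) (+) R(d2) of Theta. *)
Definition target_shift (d1 d2 : nat) (i : 'I_2) : int := - (row_deg d1 d2 i)%:Z.

Definition mx_rank_frac (k : fieldType) (n p q : nat)
    (A : 'M[{mpoly k[n]}]_(p, q)) : nat :=
  \rank (map_mx (@tofrac {mpoly k[n]}) A).

Definition row_gcd1 (k : fieldType) (n p q : nat) (A : 'M[{mpoly k[n]}]_(p, q))
    (i : 'I_p) : Prop :=
  forall h, (forall j, exists c, A i j = c * h) -> h \is a GRing.unit.

Definition syz (k : fieldType) (n p q : nat) (A : 'M[{mpoly k[n]}]_(p, q))
    (v : 'cV[{mpoly k[n]}]_q) : Prop :=
  A *m v = 0.

(* Elements of degree t in Syz(A), a submodule of R^q with unshifted grading. *)
Definition syz_deg (k : fieldType) (n p q : nat) (A : 'M[{mpoly k[n]}]_(p, q))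
    (t : int) (v : 'cV[{mpoly k[n]}]_q) : Prop :=
  syz A v /\ homog_vec (fun _ => 0) t v.

Definition syz_indeg (k : fieldType) (n p q : nat) (A : 'M[{mpoly k[n]}]_(p, q))
    (e : int) : Prop :=
  (exists2 v, syz_deg A e v & v != 0) /\
  (forall t v, syz_deg A t v -> v != 0 -> e <= t).

(* Homogeneous of degree t and not in (x_1, ..., x_n) Syz(A). *)
Definition syz_min_gen (k : fieldType) (n p q : nat) (A : 'M[{mpoly k[n]}]_(p, q))
    (t : int) (v : 'cV[{mpoly k[n]}]_q) : Prop :=
  syz_deg A t v /\
  ~ exists w : 'I_n -> 'cV_q, (forall i, syz A (w i)) /\ v = \sum_i 'X_i *: w i.

Definition syz_free (k : fieldType) (n p q : nat)
    (A : 'M[{mpoly k[n]}]_(p, q)) : Prop :=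
  exists r (B : 'M[{mpoly k[n]}]_(q, r)),
    A *m B = 0 /\ forall v, syz A v -> exists! c : 'cV_r, v = B *m c.

Definition homog_ideal (k : fieldType) (n : nat) (I : {pred {mpoly k[n]}}) : Prop :=
  forall p d, p \in I -> pihomog mdeg d p \in I.

(* I is a homogeneous proper ideal of codimension two (dim R/I = n - 2), and phi
   induces a degree-zero graded isomorphism Syz(A) / R nu -> I(s). Only the
   values of phi on Syz(A) matter. *)
Definition bourbaki_ideal (k : fieldType) (n p q : nat)
    (A : 'M[{mpoly k[n]}]_(p, q)) (nu : 'cV[{mpoly k[n]}]_q)
    (s : int) (I : {pred {mpoly k[n]}}) : Prop :=
  [/\ idealr_closed I, homog_ideal I, krull_dim (gquot I) (n - 2)
    & exists phi : 'cV[{mpoly k[n]}]_q -> {mpoly k[n]},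
        [/\ forall x v w, syz A v -> syz A w -> phi (x *: v + w) = x * phi v + phi w,
            forall y, y \in I <-> exists2 v, syz A v & phi v = y,
            forall v, syz A v -> (phi v = 0 <-> exists x, v = x *: nu)
          & forall t v, syz_deg A t v -> homogz (t + s) (phi v)]].

(* b is the Bourbaki degree of A. *)
Definition bourbaki_degree (k : fieldType) (n p q : nat)
    (A : 'M[{mpoly k[n]}]_(p, q)) (b : rat) : Prop :=
  (syz_free A /\ b = 0) \/
  (~ syz_free A /\
   exists e nu s I,
     [/\ syz_indeg A e, syz_deg A e nu, nu != 0, bourbaki_ideal A nu s I
       & gdegree (gquot I) b]).

(* Complexes F3 -> F2 -> F1 -> F0 of graded free modules. *)
Record gcomplex3 (k : fieldType) (n : nat) := GComplex3 {
  cr0 : nat; cr1 : nat; cr2 : nat; cr3 : nat;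
  cs0 : 'I_cr0 -> int;
  cs1 : 'I_cr1 -> int;
  cs2 : 'I_cr2 -> int;
  cs3 : 'I_cr3 -> int;
  cd1 : 'M[{mpoly k[n]}]_(cr0, cr1);
  cd2 : 'M[{mpoly k[n]}]_(cr1, cr2);
  cd3 : 'M[{mpoly k[n]}]_(cr2, cr3)
}.
Arguments cs0 {k n} C : rename.
Arguments cs1 {k n} C : rename.
Arguments cs2 {k n} C : rename.
Arguments cs3 {k n} C : rename.

(* The augmentation F0 -> M is given by a lift eps to the free module
   presenting M. *)
Definition graded_free_resolution (k : fieldType) (n : nat) (M : gmod k n)
    (C : gcomplex3 k n) : Prop :=
  [/\ [/\ graded_mx (cs0 C) (cs1 C) (cd1 C),
          graded_mx (cs1 C) (cs2 C) (cd2 C)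
        & graded_mx (cs2 C) (cs3 C) (cd3 C)],
      exists eps : 'M[{mpoly k[n]}]_(grank M, cr0 C),
        [/\ graded_mx (gshift M) (cs0 C) eps,
            forall w : 'cV_(grank M), exists y, grel M (w - eps *m y)
          & forall y, grel M (eps *m y) <-> exists z, y = cd1 C *m z],
      forall z : 'cV_(cr1 C), cd1 C *m z = 0 <-> exists u, z = cd2 C *m u,
      forall u : 'cV_(cr2 C), cd2 C *m u = 0 <-> exists c, u = cd3 C *m c
    & forall c : 'cV_(cr3 C), cd3 C *m c = 0 -> c = 0].

Definition in_irrelevant (k : fieldType) (n p q : nat)
    (A : 'M[{mpoly k[n]}]_(p, q)) : Prop :=
  forall i j, (A i j)@_0%MM = 0.

Definition minimal_complex (k : fieldType) (n : nat) (C : gcomplex3 k n) : Prop :=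
  [/\ in_irrelevant (cd1 C), in_irrelevant (cd2 C) & in_irrelevant (cd3 C)].

Definition minimal_graded_free_resolution (k : fieldType) (n : nat) (M : gmod k n)
    (C : gcomplex3 k n) : Prop :=
  graded_free_resolution M C /\ minimal_complex C.

(* For A of size m x (m+2), the skew-symmetric matrix whose (i,j) entry is, up to
   sign, the maximal minor of A on the columns other than i and j. For m = 2 the
   entries are the 2-minors of A; for m = 1 this is a Koszul differential. *)
Definition br_psi (k : fieldType) (n m : nat) (A : 'M[{mpoly k[n]}]_(m, m.+2)) :
    'M[{mpoly k[n]}]_m.+2 :=
  \matrix_(i, j)
    match unlift i j with
    | Some l => (-1) ^+ (i + l) * \det (col' l (col' i A))
    | None => 0
    end.

(* With F = (+)_j R(- b j), G = (+)_i R(- a i) and delta = sum b - sum a, the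
   complex G^*(-delta) -> F^*(-delta) -> F -> G with maps A^T, psi, A. For
   A = Theta, where b = 0 and a = (-d1, -d2), this is
     R(-2d1-d2) (+) R(-d1-2d2) -> R^4(-d1-d2) -> R^4 -> R(d1) (+) R(d2). *)
Definition buchsbaum_rim (k : fieldType) (n m : nat) (a : 'I_m -> int)
    (b : 'I_m.+2 -> int) (A : 'M[{mpoly k[n]}]_(m, m.+2)) : gcomplex3 k n :=
  let delta := \sum_j b j - \sum_i a i in
  GComplex3 a b (fun j => delta - b j) (fun i => delta - a i) A (br_psi A) A^T.

(* Main.v *)
(** Hilbert functions are additive along the two exact sequences
      0 -> Syz -> R^4 -> R(d1) (+) R(d2) -> Q -> 0   and   0 -> R(-e) -> Syz -> I(s) -> 0,
    so HP_Q is a combination of shifts of the Hilbert polynomial of R and of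
    that of R/I.  As I has codimension two, the latter starts with the term
    Bour/(n-3)! t^(n-3); the coefficient of t^(n-2) then gives
    s = e_0 + e - d, and that of t^(n-3) gives Bour.

    The passage from Krull dimension to homogeneous regular sequences is an
    unrolled Noether normalization.  If a homogeneous ideal J of
    k[x_1, ..., x_n] is nonzero, a linear change of coordinates (k is infinite)
    makes some element of J monic in the last variable, so chains of primes over
    J' = J meet k[x_1, ..., x_(n-1)] lift to chains of primes over J (going
    up), and a regular sequence in J' followed upwards is regular modulo the
    monic element.  No Noetherian hypothesis enters: primes come from Zorn's
    lemma.

    If dim Q <= n - 3, the ideal of 2-minors of Theta contains a regular
    sequence of length three.  Its elements annihilate the homology of the
    Buchsbaum-Rim complex, which forces exactness; hence Syz is generated in
    degree d, so e = d, and HP_Q can be read off the resolution. *)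

From HB Require Import structures.
Require Import Defs.
From mathcomp Require Import perm archimedean polyrcf boolp classical_sets.
From mathcomp Require Import ring lra zify.

Set Implicit Arguments.
Unset Strict Implicit.
Unset Printing Implicit Defensive.

Import Order.TTheory GRing.Theory Num.Theory.
Local Open Scope ring_scope.

(** * Ideals, prime chains and regular sequences *)

(** Krull dimension is given by chains of primes, the Bourbaki degree by Hilbert functions;
    homogeneous regular sequences are the bridge. Two forms in the Bourbaki ideal I bound the
    Hilbert polynomial of R/I by that of a complete intersection, which is why it has degree at most
    n - 3; three forms in the ideal of minors drive the acyclicity argument.

    When d1 = 0 the first row of Theta consists of constants, so its Buchsbaum-Rim complex is a
    resolution but not a minimal one. Clearing the constant row leaves three forms of degree d2
    whose Koszul complex is the minimal resolution. That complex is the Buchsbaum-Rim complex of a 1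
    x 3 matrix, hence the arbitrary size m in [buchsbaum_rim]. *)

Section Ideals.
Variable A : comNzRingType.
Implicit Types (I J K P : A -> Prop).

(** Ideals are [Prop]-valued because Zorn's lemma yields undecided predicates. The Boolean
    predicates of [prime_chain] are recovered through [asbool] in [krull_dim_chain]. *)
Record ideal I : Prop := Ideal {
  ideal0 : I 0;
  idealD : forall x y, I x -> I y -> I (x + y);
  idealM : forall a x, I x -> I (a * x)
}.

Record prime_ideal P : Prop := PrimeIdeal {
  prime_ideal_ideal :> ideal P;
  prime_ideal1 : ~ P 1;
  prime_idealM : forall x y, P (x * y) -> P x \/ P y
}.

Lemma idealN I x : ideal I -> I x -> I (- x).
Proof. by move=> hI hx; rewrite -mulN1r; apply: idealM. Qed.

Lemma idealB I x y : ideal I -> I x -> I y -> I (x - y).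
Proof. by move=> hI hx hy; apply: idealD => //; apply: idealN. Qed.

Lemma ideal_sum I (T : Type) (r : seq T) (Q : pred T) F :
  ideal I -> (forall i, Q i -> I (F i)) -> I (\sum_(i <- r | Q i) F i).
Proof.
move=> hI hF; elim/big_rec: _ => [|i x Qi hx]; first exact: ideal0.
by apply: idealD => //; apply: hF.
Qed.

Lemma prime_idealX P x m : prime_ideal P -> P (x ^+ m) -> P x.
Proof.
move=> hP; elim: m => [|m IH]; first by rewrite expr0 => /(prime_ideal1 hP).
by rewrite exprS => /(prime_idealM hP) [|/IH].
Qed.

Definition ideal_adjoin K f : A -> Prop :=
  fun x => exists z a, K z /\ x = z + a * f.

Lemma ideal_adjoin_ideal K f : ideal K -> ideal (ideal_adjoin K f).
Proof.
move=> hK; split.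
- by exists 0, 0; rewrite mul0r addr0; split=> //; apply: ideal0.
- move=> _ _ [z [a [hz ->]]] [z' [a' [hz' ->]]].
  by exists (z + z'), (a + a'); split; [apply: idealD | ring].
- move=> b _ [z [a [hz ->]]].
  by exists (b * z), (b * a); split; [apply: idealM | ring].
Qed.

(** An ideal M maximal among those disjoint from a multiplicative set is prime: for x and y outside
    M, both M + (x) and M + (y) meet S, and the product of the two elements found lies in M +
    (xy). *)
Lemma prime_avoid K (S : A -> Prop) :
  ideal K -> S 1 -> (forall x y, S x -> S y -> S (x * y)) ->
  (forall x, K x -> ~ S x) ->
  exists P, [/\ prime_ideal P, forall x, K x -> P x & forall x, P x -> ~ S x].
Proof.
move=> hK S1 SM KS.
(* Zorn is applied to the sets X such that X `|` K is good, so that the empty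
   chain needs no special treatment. *)
pose good I := ideal I /\ forall x, I x -> ~ S x.
have [F Ffam Ftot|X [[hX XS] Xmax]] :=
    @Zorn_bigcup A (fun X => good (fun x => X x \/ K x)).
  split; last by move=> x [[X FX Xx]|/KS //]; case: (Ffam _ FX) => _; apply; left.
  split.
  - by right; apply: ideal0.
  - move=> x y [[X FX Xx]|Kx] [[Y FY Yy]|Ky].
    + have [XY|YX] := Ftot _ _ FX FY.
        have [[_ hD _] _] := Ffam _ FY.
        have [] := hD x y (or_introl (XY _ Xx)) (or_introl Yy); last by right.
        by left; exists Y.
      have [[_ hD _] _] := Ffam _ FX.
      have [] := hD x y (or_introl Xx) (or_introl (YX _ Yy)); last by right.
      by left; exists X.
    + have [[_ hD _] _] := Ffam _ FX.
      have [] := hD x y (or_introl Xx) (or_intror Ky); last by right.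
      by left; exists X.
    + have [[_ hD _] _] := Ffam _ FY.
      have [] := hD x y (or_intror Kx) (or_introl Yy); last by right.
      by left; exists Y.
    + by right; apply: idealD.
  - move=> a x [[X FX Xx]|Kx]; last by right; apply: idealM.
    have [[_ _ hM] _] := Ffam _ FX.
    have [] := hM a x (or_introl Xx); last by right.
    by left; exists X.
pose M x := X x \/ K x.
have Mmax N f : ideal N -> (forall x, M x -> N x) -> N f -> ~ M f ->
    exists2 x, N x & S x.
  move=> hN MN Nf nMf; apply: contrapT => hS.
  apply: (Xmax N); last first.
    split; last by move=> x [Nx|/KS //] Sx; apply: hS; exists x.
    suff -> : (fun x => N x \/ K x) = N by [].
    apply/funext => x; apply/propext; split; last by left.
    by case=> // Kx; apply: MN; right.
  by split=> [x Xx|NX]; [apply: MN; left | apply: nMf; left; apply: NX].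
exists M; split=> //; last by move=> x; right.
split=> // [M1|x y Mxy]; first exact: XS _ M1 S1.
apply: contrapT => /not_orP [nMx nMy].
have adj f : ~ M f -> exists z a, M z /\ S (z + a * f).
  move=> nMf; have [|||_ [z [a [Mz ->]]] Sx] := Mmax (ideal_adjoin M f) f _ _ _ nMf.
  - exact: ideal_adjoin_ideal.
  - by move=> w Mw; exists w, 0; rewrite mul0r addr0.
  - by exists 0, 1; rewrite mul1r add0r; split=> //; apply: ideal0.
  - by exists z, a.
have [z [a [Mz Sz]]] := adj _ nMx; have [z' [a' [Mz' Sz']]] := adj _ nMy.
apply: (XS _ _ (SM _ _ Sz Sz')).
have -> : (z + a * x) * (z' + a' * y)
    = (z' + a' * y) * z + (a * x * z' + (a * a') * (x * y)) by ring.
by apply: (idealD hX); [|apply: (idealD hX)]; apply: (idealM hX).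
Qed.

Lemma det_congr I D (M N : 'M[A]_D) : ideal I ->
  (forall i j, I (M i j - N i j)) -> I (\det M - \det N).
Proof.
move=> hI hMN; rewrite /determinant -sumrB; apply: ideal_sum => // s _.
rewrite -mulrBr; apply: idealM => //.
elim/big_rec2: _ => [|i x y _ hxy]; first by rewrite subrr; apply: ideal0.
have -> : M i (s i) * y - N i (s i) * x = y * (M i (s i) - N i (s i)) + N i (s i) * (y - x).
  by ring.
by apply: (idealD hI); apply: (idealM hI).
Qed.

Definition prime_chain_over J m (P : nat -> A -> Prop) : Prop :=
  (forall i, (i <= m)%N -> prime_ideal (P i) /\ forall x, J x -> P i x) /\
  (forall i, (i < m)%N ->
     (forall x, P i x -> P i.+1 x) /\ exists2 x, P i.+1 x & ~ P i x).

(* Weakly regular modulo K: the quotient is allowed to vanish. *)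
Fixpoint regular_seq K (s : seq A) : Prop :=
  if s is f :: s' then
    (forall x, K (f * x) -> K x) /\ regular_seq (ideal_adjoin K f) s'
  else True.

End Ideals.

Lemma ideal_comap (A B : comNzRingType) (f : {rmorphism A -> B}) (I : B -> Prop) :
  ideal I -> ideal (fun x => I (f x)).
Proof.
move=> hI; split; first by rewrite rmorph0; apply: ideal0.
- by move=> x y hx hy; rewrite rmorphD; apply: idealD.
- by move=> a x hx; rewrite rmorphM; apply: idealM.
Qed.

Lemma prime_ideal_comap (A B : comNzRingType) (f : {rmorphism A -> B})
  (P : B -> Prop) : prime_ideal P -> prime_ideal (fun x => P (f x)).
Proof.
move=> hP; split; first exact: ideal_comap hP.
- by rewrite rmorph1; apply: prime_ideal1.
- by move=> x y; rewrite rmorphM => /(prime_idealM hP).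
Qed.

Lemma regular_seq_iso (A B : comNzRingType) (f : {rmorphism A -> B})
    (g : {rmorphism B -> A}) (K : B -> Prop) (s : seq A) :
  cancel f g -> cancel g f ->
  regular_seq K (map f s) -> regular_seq (fun x => K (f x)) s.
Proof.
move=> fK gK; elim: s K => //= a s IH K [ha /IH hs]; split.
  by move=> x; rewrite rmorphM => /ha.
suff -> : ideal_adjoin (fun x => K (f x)) a = fun x => ideal_adjoin K (f a) (f x) by [].
apply/funext => x; apply/propext; split.
  by case=> z [b [Kz ->]]; exists (f z), (f b); rewrite rmorphD rmorphM.
case=> z [b [Kz E]]; exists (g z), (g b); rewrite gK; split=> //.
by apply: (can_inj fK); rewrite E rmorphD rmorphM /= !gK.
Qed.

(** * Primes and regular sequences along a monic extension *)

Section MonicExtension.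
Variable A : idomainType.
Implicit Types (K : {poly A} -> Prop) (p : A -> Prop) (a : {poly A}).

(** A[X]/K is integral over the image of A since K contains a monic. The prime is chosen to contain
    L = K + p A[X] and to avoid the constants outside p; that L avoids them is [Lp]. *)
Lemma lying_over K a p : ideal K -> a \is monic -> K a -> prime_ideal p ->
  (forall c, K c%:P -> p c) ->
  exists P, [/\ prime_ideal P, forall x, K x -> P x & forall c, P c%:P <-> p c].
Proof.
move=> hK moa Ka hp hKp.
pose L f := exists z w : {poly A}, [/\ K z, forall i, p w`_i & f = z + w].
have hL : ideal L.
  split.
  - exists 0, 0; rewrite addr0; split=> // [|i]; first exact: ideal0.
    by rewrite coef0; apply: (ideal0 hp).
  - move=> _ _ [z [w [Kz pw ->]]] [z' [w' [Kz' pw' ->]]].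
    exists (z + z'), (w + w'); split; [exact: idealD| |by ring].
    by move=> i; rewrite coefD; apply: (idealD hp).
  - move=> b _ [z [w [Kz pw ->]]]; exists (b * z), (b * w); split.
    + exact: idealM.
    + by move=> i; rewrite coefM; apply: (ideal_sum _ hp) => j _; apply: (idealM hp).
    + by ring.
have Lp c : L c%:P -> p c.
  case=> z [w [Kz pw E]].
  pose D := (size a).-1.
  have Da : (D.+1 = size a) by rewrite /D prednK // size_poly_gt0 monic_neq0.
  have prem (u : {poly A}) j : (forall i, p u`_i) -> p (Pdiv.Ring.rmodp u a)`_j.
    move=> pu; rewrite -[u]coefK poly_def Pdiv.RingMonic.rmodp_sum // coef_sum.
    apply: (ideal_sum _ hp) => i _; rewrite Pdiv.RingMonic.rmodpZ // coefZ mulrC.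
    exact: (idealM hp).
  (* Determinant trick: multiplication by c on A[X]/(a), with basis 1, ..., X^(D-1),
     agrees modulo K with a matrix M having entries in p, so det (c - M) is in K. *)
  pose M := \matrix_(i < D, j < D) (Pdiv.Ring.rmodp (w * 'X^i) a)`_j.
  have pM i j : p (M i j).
    rewrite mxE; apply: prem => l; rewrite coefMXn.
    by case: ifP => _ //; apply: (ideal0 hp).
  pose N := c%:M - M.
  pose v : 'cV[{poly A}]_D := \col_i 'X^i.
  have KN i : K ((map_mx polyC N *m v) i 0).
    have -> : (map_mx polyC N *m v) i 0 =
        'X^i * z + Pdiv.Ring.rdivp (w * 'X^i) a * a.
      have Erem : \sum_j (M i j)%:P * 'X^j = Pdiv.Ring.rmodp (w * 'X^i) a.
        under eq_bigr => j _ do rewrite mxE mul_polyC.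
        rewrite -(poly_def D (fun j => (Pdiv.Ring.rmodp (w * 'X^i) a)`_j)).
        apply/polyP => j; rewrite coef_poly; case: ltnP => // Dj.
        rewrite nth_default // (leq_trans _ Dj) // -ltnS Da.
        by rewrite Pdiv.Ring.ltn_rmodpN0 // monic_neq0.
      rewrite mxE; under eq_bigr => j _ do rewrite !mxE rmorphB mulrBl.
      rewrite sumrB; have -> : \sum_j (c *+ (i == j))%:P * 'X^j = c%:P * 'X^i.
        rewrite (bigD1 i) //= eqxx big1 ?addr0 // => j /negbTE ji.
        by rewrite eq_sym ji mul0r.
      have <- : \sum_(j < D) (M i j)%:P * 'X^j
              = \sum_(j < D) ((Pdiv.Ring.rmodp (w * 'X^i) a)`_j)%:P * 'X^j.
        by apply: eq_bigr => j _; rewrite mxE.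
      rewrite Erem E [in LHS](_ : (z + w) * 'X^i = 'X^i * z + w * 'X^i); last by ring.
      by rewrite [X in _ + X - _](Pdiv.RingMonic.rdivp_eq moa) addrA addrK.
    by apply: (idealD hK); apply: (idealM hK).
  have KdetN (i : 'I_D) : K ((\det N)%:P * 'X^i).
    have -> : (\det N)%:P * 'X^i = (\adj (map_mx polyC N) *m (map_mx polyC N *m v)) i 0.
      by rewrite mulmxA mul_adj_mx det_map_mx mul_scalar_mx !mxE.
    by rewrite mxE; apply: ideal_sum => // j _; apply: (idealM hK).
  (* [KdetN] needs an index; for D = 0 the monic is 1 and K is the unit ideal. *)
  have [D0|D0] := posnP D.
    have a1 : a = 1.
      move: Da; rewrite D0 => /esym/eqP/size_poly1P [x _ Ex].
      by move: moa; rewrite Ex monicE lead_coefC => /eqP ->.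
    by apply: hKp; rewrite -[c%:P]mulr1 -a1; apply: (idealM hK).
  have pdet : p (\det N) by apply: hKp; have := KdetN (Ordinal D0); rewrite expr0 mulr1.
  (* Modulo p the matrix N is the scalar matrix c, so det N is congruent to c ^ D. *)
  apply: (@prime_idealX _ p c D) => //.
  have -> : c ^+ D = \det N - (\det N - \det (c%:M : 'M_D)) by rewrite det_scalar; ring.
  apply: (idealB hp) => //; apply: (det_congr hp) => i j.
  have -> : N i j - (c%:M : 'M_D) i j = - M i j by rewrite !mxE; ring.
  exact: (idealN hp).
have [|x y|x|P [hP LP SP]] := @prime_avoid _ L (fun f => exists2 c, f = c%:P & ~ p c) hL.
- by exists 1 => //; apply: prime_ideal1.
- move=> [c -> pc] [d -> pd]; exists (c * d); first by rewrite polyCM.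
  by case/(prime_idealM hp).
- by move=> Lx [c E pc]; apply: pc; apply: Lp; rewrite -E.
exists P; split=> // [x Kx|c].
  apply: LP; exists x, 0; rewrite addr0; split=> // i.
  by rewrite coef0; apply: (ideal0 hp).
split=> [Pc|pc]; first by apply: contrapT => npc; apply: (SP _ Pc); exists c.
apply: LP; exists 0, c%:P; rewrite add0r; split=> // [|i]; first exact: ideal0.
by rewrite coefC; case: eqP => // _; apply: (ideal0 hp).
Qed.

(** Once the bottom prime is lifted to P0, the induction hypothesis applies with P0 in the role of
    K: P0 contracts exactly to p 0, so the rest of the chain lies over that contraction. Exact
    contractions also keep the lifted chain strict. *)
Lemma going_up K a m (p : nat -> A -> Prop) : ideal K -> a \is monic -> K a ->
  prime_chain_over (fun c => K c%:P) m p ->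
  exists P, prime_chain_over K m P /\
    forall i c, (i <= m)%N -> (P i c%:P <-> p i c).
Proof.
move=> + moa; elim: m K p => [|m IH] K p hK Ka [p_prime p_inc].
  have [hp0 Kp0] := p_prime 0%N isT.
  have [P [hP KP Pp]] := lying_over hK moa Ka hp0 Kp0.
  by exists (fun=> P); split; [split | move=> [|i]].
have [hp0 Kp0] := p_prime 0%N isT.
have [P0 [hP0 KP0 Pp0]] := lying_over hK moa Ka hp0 Kp0.
have p0_le i : (i <= m.+1)%N -> forall c, p 0%N c -> p i c.
  elim: i => // i IHi im c pc; have [/(_ c) h _] := p_inc i im.
  by apply/h/IHi => //; apply: ltnW.
have [|P [[P_prime P_inc] Pp]] := IH P0 (fun i => p i.+1) hP0 (KP0 _ Ka).
  split=> [i im|i im]; last exact: p_inc.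
  have [hpi _] := p_prime i.+1 im; split=> // c /Pp0.
  exact: (p0_le i.+1 im).
exists (fun i => if i is j.+1 then P j else P0); split; last by case=> // i c; apply: Pp.
split=> [[|i] im|[|i] im] //.
- by have [hPi P0i] := P_prime i im; split=> // x /KP0 /P0i.
- split; first by have [] := P_prime 0%N isT.
  have [_ [c p1c np0c]] := p_inc 0%N isT.
  by exists c%:P; [apply/Pp | move/Pp0].
- exact: P_inc.
Qed.

(* p A[X] + (a), for a monic. *)
Definition poly_ideal p a : {poly A} -> Prop :=
  fun q => forall i, p (Pdiv.Ring.rmodp q a)`_i.

Lemma poly_ideal_adjoin p a f : ideal p -> a \is monic ->
  ideal_adjoin (poly_ideal p a) f%:P = poly_ideal (ideal_adjoin p f) a.
Proof.
move=> hp moa; apply/funext => q; apply/propext; split.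
  case=> z [b [pz ->]] i; exists (Pdiv.Ring.rmodp z a)`_i, (Pdiv.Ring.rmodp b a)`_i.
  split=> //; rewrite Pdiv.RingMonic.rmodpD // coefD mulrC mul_polyC.
  by rewrite Pdiv.RingMonic.rmodpZ // coefZ mulrC.
move=> hq; have /choice [F hF] : forall i, exists zb : A * A,
    p zb.1 /\ (Pdiv.Ring.rmodp q a)`_i = zb.1 + zb.2 * f.
  by move=> i; have [z [b [pz E]]] := hq i; exists (z, b).
pose D := (size a).-1.
have Da : (D.+1 = size a) by rewrite /D prednK // size_poly_gt0 monic_neq0.
pose z := \poly_(i < D) (F i).1; pose b := \poly_(i < D) (F i).2.
exists (Pdiv.Ring.rdivp q a * a + z), b; split; last first.
  rewrite {1}[q](Pdiv.RingMonic.rdivp_eq moa) -addrA; congr (_ + _).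
  apply/polyP => i; rewrite coefD coefMC !coef_poly.
  case: ltnP => Di; first by have [_ ->] := hF i.
  rewrite mul0r addr0 nth_default // (leq_trans _ Di) // -ltnS Da.
  by rewrite Pdiv.Ring.ltn_rmodpN0 // monic_neq0.
move=> i; rewrite Pdiv.RingMonic.rmodp_addl_mul_small //; last first.
  by rewrite -Da ltnS size_poly.
by rewrite coef_poly; case: ifP => _; [have [] := hF i | apply: ideal0].
Qed.

(** A[X]/(a) is free over A, and a constant multiplies remainders coefficient by coefficient, so
    regularity is inherited from A. *)
Lemma regular_seq_poly p a s : ideal p -> a \is monic ->
  regular_seq p s -> regular_seq (poly_ideal p a) (map polyC s).
Proof.
move=> hp moa; elim: s p hp => //= f s IH p hp [hf hs]; split.
  move=> q hq i; apply: hf; have := hq i.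
  by rewrite mul_polyC Pdiv.RingMonic.rmodpZ // coefZ.
by rewrite poly_ideal_adjoin //; apply: IH => //; apply: ideal_adjoin_ideal.
Qed.

Lemma regular_seq_monic a s : a \is monic ->
  regular_seq (fun c : A => c = 0) s ->
  regular_seq (fun q : {poly A} => q = 0) (a :: map polyC s).
Proof.
move=> moa hs; split.
  by move=> x /eqP; rewrite mulf_eq0 (negbTE (monic_neq0 moa)) => /eqP.
suff -> : ideal_adjoin (fun q : {poly A} => q = 0) a = poly_ideal (fun c => c = 0) a.
  apply: regular_seq_poly => //; split=> // [x y -> ->|x y ->].
    by rewrite addr0.
  by rewrite mulr0.
apply/funext => q; apply/propext; split.
  by case=> z [b [-> ->]] i; rewrite add0r Pdiv.RingMonic.rmodp_mull // coef0.
move=> hq; exists 0, (Pdiv.Ring.rdivp q a); split=> //; rewrite add0r.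
rewrite {1}[q](Pdiv.RingMonic.rdivp_eq moa) (_ : Pdiv.Ring.rmodp q a = 0) ?addr0 //.
by apply/polyP => i; rewrite coef0.
Qed.

End MonicExtension.

(** * Krull dimension and homogeneous regular sequences *)

Section MPoly.
Variable k : fieldType.
Implicit Types (n d : nat).

Local Notation widen := (widen_ord (leqnSn _)).

Lemma mpoly_rmorph_eq n (S : comNzRingType) (f g : {rmorphism {mpoly k[n]} -> S}) :
  (forall c, f c%:MP = g c%:MP) -> (forall i, f 'X_i = g 'X_i) -> f =1 g.
Proof.
move=> fgC fgX p; rewrite [p]mpolyE !rmorph_sum; apply: eq_bigr => m _.
rewrite -mul_mpolyC !rmorphM fgC mpolyXE_id !rmorph_prod; congr (_ * _).
by apply: eq_bigr => i _; rewrite !rmorphXn fgX.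
Qed.

Lemma comp_mpoly_homog n m (t : n.-tuple {mpoly k[m]}) d (f : {mpoly k[n]}) :
  (forall i, tnth t i \is 1.-homog) -> f \is d.-homog -> f \mPo t \is d.-homog.
Proof.
move=> ht /dhomogP hf; rewrite comp_mpolyE big_seq; apply: rpred_sum => u /hf <-.
apply: rpredZ; rewrite /= mdegE.
elim/big_rec2: _ => [|i e p _ hp]; first exact: dhomog1.
by apply: dhomogM => //; have := dhomogMn (u i) (ht i); rewrite mul1n.
Qed.

Lemma pihomog_additive n m (F : {additive {mpoly k[n]} -> {mpoly k[m]}}) d f :
  (forall d f, f \is d.-homog -> F f \is d.-homog) ->
  pihomog mdeg d (F f) = F (pihomog mdeg d f).
Proof.
move=> hF; pose N := maxn d.+1 (mmeasure mdeg f).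
transitivity (\sum_(i < N) pihomog mdeg d (F (pihomog mdeg i f))).
  by rewrite -!raddf_sum -pihomog_partitionE // leq_maxr.
have dN : (d < N)%N by rewrite leq_max ltnSn.
rewrite (bigD1 (Ordinal dN)) //= pihomog_dE ?hF ?pihomogP // big1 ?addr0 // => i id.
apply: (@pihomog_ne0 _ _ _ i); last by rewrite hF // pihomogP.
by apply: contra_neq id => id; apply/val_inj.
Qed.

Lemma mwiden_comp n (f : {mpoly k[n]}) : mwiden f = f \mPo [tuple 'X_(widen i) | i < n].
Proof.
rewrite /mwiden /comp_mpoly; apply: eq_bigr => u _; congr (_ * _).
by apply: mmap1_eq => i; rewrite tnth_mktuple.
Qed.

Lemma mwiden_homog n d (f : {mpoly k[n]}) : f \is d.-homog -> mwiden f \is d.-homog.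
Proof.
rewrite mwiden_comp; apply: comp_mpoly_homog => i.
by rewrite tnth_mktuple dhomogX; apply/eqP; apply: mdeg1.
Qed.

Lemma muni_coef n (f : {mpoly k[n.+1]}) i :
  (muni f)`_i = \sum_(m <- msupp f | m ord_max == i)
     f@_m *: 'X_[[multinom (m (widen j)) | j < n]].
Proof.
rewrite muniE coef_sum [RHS]big_mkcond; apply: eq_bigr => m _.
by rewrite coefZ coefXn eq_sym; case: eqP; rewrite ?mulr1 ?mulr0.
Qed.

Lemma muni_coef_homog n d (f : {mpoly k[n.+1]}) i : f \is d.-homog ->
  (muni f)`_i \is (d - i).-homog.
Proof.
move=> /dhomogP hf; rewrite muni_coef big_seq_cond; apply: rpred_sum => m /andP [/hf <- /eqP <-].
apply: rpredZ; rewrite dhomogX; apply/eqP.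
rewrite /= !mdegE big_ord_recr /= addnK; apply: eq_bigr => j _; by rewrite mnmE.
Qed.

Lemma muni_coef_gt n d (f : {mpoly k[n.+1]}) i : f \is d.-homog -> (d < i)%N ->
  (muni f)`_i = 0.
Proof.
move=> /dhomogP hf di; rewrite muni_coef big_seq_cond big1 // => m /andP [/hf dm /eqP mi].
by move: di; rewrite -dm -mi /= mdegE big_ord_recr /= ltnNge leq_addl.
Qed.

Lemma muni_mwiden n (c : {mpoly k[n]}) : muni (mwiden c) = c%:P.
Proof.
pose f : {rmorphism {mpoly k[n]} -> {poly {mpoly k[n]}}} := @muni n k \o @mwiden n k.
apply: (@mpoly_rmorph_eq n _ f polyC) => [a|i]; rewrite /f /=.
  by rewrite mwidenC muniC.
rewrite mwidenX muniE msuppX big_seq1 mcoeffX eqxx scale1r mnmwiden_ordmax.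
rewrite expr0 -[_ *: 1]mul_polyC mulr1; congr (_%:P); congr 'X_[_].
by apply/mnmP => j; rewrite mnmE mnmwiden_widen.
Qed.

Lemma muni_Xmax n : muni ('X_ord_max : {mpoly k[n.+1]}) = 'X.
Proof.
rewrite muniE msuppX big_seq1 mcoeffX eqxx scale1r mnm1E eqxx expr1.
rewrite (_ : [multinom _ | j < n] = 0%MM) ?mpolyX0 ?scale1r //.
by apply/mnmP => j; rewrite mnmE mnm1E mnm0E eqE /= gtn_eqF.
Qed.

Definition muni_inv n : {poly {mpoly k[n]}} -> {mpoly k[n.+1]} :=
  horner_eval 'X_ord_max \o map_poly (@mwiden n k).

HB.instance Definition _ n := GRing.RMorphism.copy (@muni_inv n)
  (horner_eval ('X_ord_max : {mpoly k[n.+1]}) \o map_poly (@mwiden n k)).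

Arguments muni_inv : simpl never.

Lemma muni_invC n (c : {mpoly k[n]}) : muni_inv c%:P = mwiden c.
Proof. by rewrite /muni_inv /= map_polyC /horner_eval hornerC. Qed.

Lemma muni_invX n : muni_inv 'X = 'X_ord_max :> {mpoly k[n.+1]}.
Proof. by rewrite /muni_inv /= map_polyX /horner_eval hornerX. Qed.

Lemma muni_invK n : cancel (@muni_inv n) (@muni n k).
Proof.
move=> p; rewrite -[p]coefK poly_def !rmorph_sum; apply: eq_bigr => i _.
by rewrite -mul_polyC !rmorphM /= muni_invC !rmorphXn /= muni_invX muni_mwiden muni_Xmax.
Qed.

Lemma muniK n : cancel (@muni n k) (@muni_inv n).
Proof.
pose f : {rmorphism {mpoly k[n.+1]} -> {mpoly k[n.+1]}} := @muni_inv n \o @muni n k.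
apply: (@mpoly_rmorph_eq _ _ f idfun) => [a|i].
  by rewrite -[LHS]/(muni_inv (muni _)) muniC muni_invC mwidenC.
rewrite -[LHS]/(muni_inv (muni _)) /=.
case: (unliftP ord_max i) => [j ->|->]; last by rewrite muni_Xmax muni_invX.
have -> : lift ord_max j = widen j by apply/val_inj; rewrite /= /bump leqNgt ltn_ord.
by rewrite -mnmwiden1 -mwidenX muni_mwiden muni_invC.
Qed.

Lemma meval_muni n (f : {mpoly k[n.+1]}) (v : 'I_n.+1 -> k) :
  f.@[v] = (map_poly (meval (fun i => v (widen i))) (muni f)).[v ord_max].
Proof.
pose g : {rmorphism {mpoly k[n.+1]} -> k} := horner_eval (v ord_max) \o
   (map_poly (meval (fun i => v (widen i))) \o @muni n k).
pose h : {rmorphism {mpoly k[n.+1]} -> k} := meval v.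
apply: (@mpoly_rmorph_eq _ _ h g) => [a|i]; rewrite /h /g /=.
  by rewrite mevalC muniC map_polyC /= mevalC /horner_eval hornerC.
case: (unliftP ord_max i) => [j ->|->]; last first.
  by rewrite muni_Xmax map_polyX /horner_eval hornerX mevalXU.
have -> : lift ord_max j = widen j by apply/val_inj; rewrite /= /bump leqNgt ltn_ord.
rewrite -{2}mnmwiden1 -mwidenX muni_mwiden map_polyC /= !mevalXU.
by rewrite /horner_eval hornerC.
Qed.

Lemma infinite_uniq (hk : infinite_field k) N : exists2 s : seq k, uniq s & size s = N.
Proof.
elim: N => [|N [s us sN]]; first by exists [::].
by have [x xs] := hk s; exists (x :: s); rewrite /= ?xs ?us ?sN.
Qed.

Lemma meval_neq0 (hk : infinite_field k) n (f : {mpoly k[n]}) :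
  f != 0 -> exists v, f.@[v] != 0.
Proof.
elim: n f => [|n IH] f f0.
  exists (fun=> 0); rewrite [f]nvar0_mpolyC mevalC.
  by apply: contra_neq f0 => f0; rewrite [f]nvar0_mpolyC f0.
have uf0 : muni f != 0 by rewrite -(inj_eq (can_inj (@muniK n))) !rmorph0 in f0 *.
have [w hw] := IH (lead_coef (muni f)) ltac:(by rewrite lead_coef_eq0).
pose p := map_poly (meval w) (muni f).
have p0 : p != 0.
  by apply: contra_neq hw => p0; have := coef_map (meval w) (muni f) (size (muni f)).-1;
    rewrite -/p p0 coef0.
have [s us sp] := infinite_uniq hk (size p).
have /allPn [x xs px] : ~~ all (root p) s.
  by apply/negP => ps; have := max_poly_roots p0 ps us; rewrite sp ltnn.
exists (fun i => if unlift ord_max i is Some j then w j else x).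
rewrite meval_muni unlift_none (_ : map_poly _ _ = p) //.
apply: eq_map_poly => c; apply: meval_eq => j.
have -> : widen j = lift ord_max j by apply/val_inj; rewrite /= /bump leqNgt ltn_ord.
by rewrite liftK.
Qed.

Lemma meval_scale n d (f : {mpoly k[n]}) c v : f \is d.-homog ->
  f.@[fun i => c * v i] = c ^+ d * f.@[v].
Proof.
move=> /dhomogP hf; rewrite !mevalE mulr_sumr big_seq [RHS]big_seq.
apply: eq_bigr => m /hf <-; under eq_bigr do rewrite exprMn.
by rewrite big_split /= prodrXr -mdegE mulrCA.
Qed.

Lemma meval0_homog n d (f : {mpoly k[n]}) : f \is d.-homog -> (0 < d)%N ->
  f.@[fun=> 0] = 0.
Proof.
move=> hf d0; have -> : f.@[fun=> 0] = f.@[fun=> 0 * 0] by apply: meval_eq => i; rewrite mul0r.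
by rewrite (@meval_scale n d f 0 (fun=> 0)) // expr0n gtn_eqF // mul0r.
Qed.

Lemma homog0_const n (f : {mpoly k[n]}) : f \is 0.-homog -> f = (f@_0%MM)%:MP.
Proof.
move=> /dhomogP hf; apply/mpolyP => m; rewrite mcoeffC.
have [->|m0] := eqVneq 0%MM m; first by rewrite mulr1.
rewrite mulr0; apply: memN_msupp_eq0; apply: contra m0 => /hf /eqP.
by rewrite /= mdeg_eq0 eq_sym.
Qed.

Definition shear n (q : 'I_n.+1 -> k) : n.+1.-tuple {mpoly k[n.+1]} :=
  [tuple 'X_i + q i *: 'X_ord_max | i < n.+1].

Lemma shearK n (q r : 'I_n.+1 -> k) : q ord_max = 0 -> (forall i, r i = - q i) ->
  cancel (comp_mpoly (shear q)) (comp_mpoly (shear r)).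
Proof.
move=> q0 rq; pose f : {rmorphism {mpoly k[n.+1]} -> {mpoly k[n.+1]}} :=
  comp_mpoly (shear r) \o comp_mpoly (shear q).
have X (u : 'I_n.+1 -> k) i : 'X_i \mPo shear u = 'X_i + u i *: 'X_ord_max.
  by rewrite comp_mpolyXU -tnth_nth tnth_mktuple.
apply: (@mpoly_rmorph_eq _ _ f idfun) => [a|i]; rewrite /f /=.
  by rewrite !comp_mpolyC.
rewrite X comp_mpolyD comp_mpolyZ !X !rq q0 oppr0 scale0r addr0 scaleNr.
by rewrite addrNK.
Qed.

Lemma shear_homog n (q : 'I_n.+1 -> k) d (f : {mpoly k[n.+1]}) :
  f \is d.-homog -> f \mPo shear q \is d.-homog.
Proof.
apply: comp_mpoly_homog => i; rewrite tnth_mktuple.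
by apply: rpredD; [|apply: rpredZ]; rewrite dhomogX; apply/eqP; apply: mdeg1.
Qed.

(** The coefficient of X^d in the sheared form is the value of [a] at q + (0, ..., 0, 1). So q is
    read off a point where [a] does not vanish, and c is the inverse of the value there. *)
Lemma exists_shear (hk : infinite_field k) n d (a : {mpoly k[n.+1]}) :
  a != 0 -> a \is d.-homog ->
  exists q c, [/\ q ord_max = 0, c != 0 & muni ((c *: a) \mPo shear q) \is monic].
Proof.
move=> a0 ha.
(* Multiplying [a] by the last variable gives a point where both are nonzero; homogeneity then
   allows the last coordinate to be rescaled to 1. *)
have X0 : 'X_ord_max != 0 :> {mpoly k[n.+1]}.
  by rewrite -msupp_eq0 msuppX.
have [v] := meval_neq0 hk (mulf_neq0 a0 X0).
rewrite mevalM mevalXU mulf_eq0 negb_or => /andP [av vm].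
pose w i := (v ord_max)^-1 * v i; pose q i := w i - (i == ord_max)%:R.
have wm : w ord_max = 1 by rewrite /w mulVf.
have aw : a.@[w] != 0.
  by rewrite (meval_scale _ _ ha) mulf_neq0 // expf_neq0 // invr_neq0.
(* At the point [del] = (0, ..., 0, 1) the form b takes the value of its leading coefficient in the
   last variable. *)
pose b := a \mPo shear q; pose del (i : 'I_n.+1) : k := (i == ord_max)%:R.
have hb : b \is d.-homog by apply: shear_homog.
have bdel : b.@[del] = a.@[w].
  rewrite comp_mpoly_meval; apply: meval_eq => i.
  rewrite tnth_mktuple mevalD mevalZ !mevalXU /del eqxx mulr1 /q.
  by rewrite addrC subrK.
have sb : (size (muni b) <= d.+1)%N.
  by apply/leq_sizeP => i di; apply: muni_coef_gt hb di.
have bd : (muni b)`_d = (a.@[w])%:MP.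
  have h0 : (muni b)`_d \is 0.-homog by have := muni_coef_homog d hb; rewrite subnn.
  rewrite (homog0_const h0); congr (_%:MP); rewrite -bdel meval_muni.
  have -> : del ord_max = 1 by rewrite /del eqxx.
  rewrite (@horner_coef_wide _ d.+1); last by rewrite (leq_trans (size_poly _ _)).
  rewrite big_ord_recr /= expr1n mulr1 big1 ?add0r; last first.
    move=> i _; rewrite expr1n mulr1 coef_map.
    rewrite -[RHS](meval0_homog (muni_coef_homog i hb)) ?subn_gt0 //.
    by apply: meval_eq => j; rewrite /del eqE /= ltn_eqF.
  by rewrite coef_map [in RHS](homog0_const h0) /= mevalC.
exists q, (a.@[w])^-1; split; rewrite ?invr_neq0 // /q ?wm ?eqxx ?subrr //.
rewrite comp_mpolyZ muniZ monicE lead_coefZ -/b.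
have db : size (muni b) = d.+1.
  apply/eqP; rewrite eqn_leq sb /= ltnNge; apply/negP => /leq_sizeP /(_ d (leqnn d)) /eqP.
  by rewrite bd mpolyC_eq0 (negbTE aw).
by rewrite lead_coefE db /= bd -mpolyCM mulVf.
Qed.

Lemma zero_prime (A : idomainType) : prime_ideal (fun x : A => x = 0).
Proof.
split; first split=> // [x y -> ->|x y ->]; rewrite ?addr0 ?mulr0 //.
- by apply/eqP/oner_neq0.
- by move=> x y /eqP; rewrite mulf_eq0 => /orP [] /eqP; [left|right].
Qed.

(** The i-th prime is (x_1, ..., x_i), written as the kernel of the substitution killing these
    variables, so that primality is pulled back from the zero ideal. *)
Lemma zero_chain n : exists P, prime_chain_over (fun f : {mpoly k[n]} => f = 0) n P.
Proof.
pose t i : n.-tuple {mpoly k[n]} := [tuple if (j < i)%N then 0 else 'X_j | j < n].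
have X i j : 'X_j \mPo t i = if (j < i)%N then 0 else 'X_j.
  by rewrite comp_mpolyXU -tnth_nth tnth_mktuple.
exists (fun i f => f \mPo t i = 0); split=> i im.
  split; first exact: prime_ideal_comap (zero_prime _).
  by move=> f ->; rewrite comp_mpoly0.
split; last first.
  exists 'X_(Ordinal im); rewrite X /= ?ltnSn ?ltnn // => /eqP.
  by rewrite -msupp_eq0 msuppX.
have tt f : (f \mPo t i) \mPo t i.+1 = f \mPo t i.+1.
  pose g : {rmorphism {mpoly k[n]} -> {mpoly k[n]}} :=
    comp_mpoly (t i.+1) \o comp_mpoly (t i).
  apply: (@mpoly_rmorph_eq _ _ g (comp_mpoly (t i.+1))) => [a|j]; rewrite /g /=.
    by rewrite !comp_mpolyC.
  rewrite X; case: ifP => ji; rewrite ?comp_mpoly0 X ?(ltnW ji) //.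
  by rewrite ltnS ltnW.
by move=> f hf; rewrite -tt hf comp_mpoly0.
Qed.

Lemma prime_chain_comap (A B : comNzRingType) (f : {rmorphism A -> B}) (g : B -> A)
    (J : A -> Prop) (K : B -> Prop) m P :
  cancel g f -> (forall x, J x -> K (f x)) ->
  prime_chain_over K m P -> prime_chain_over J m (fun i x => P i (f x)).
Proof.
move=> gK JK [hP Pinc]; split=> i im.
  have [hPi KPi] := hP i im; split; first exact: prime_ideal_comap hPi.
  by move=> x /JK /KPi.
have [PP [x Px nPx]] := Pinc i im; split; first by move=> y; apply: PP.
by exists (g x); rewrite gK.
Qed.

(** In the induction n and c drop together, so the bound n - c on chains is the same for the
    contraction of J to one variable fewer. *)
Theorem homog_regular_seq (hk : infinite_field k) n c (J : {mpoly k[n]} -> Prop) :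
  ideal J -> (forall d f, J f -> J (pihomog mdeg d f)) -> (c <= n)%N ->
  (forall m P, prime_chain_over J m P -> (m <= n - c)%N) ->
  exists s : seq {mpoly k[n]},
    [/\ size s = c, forall f, f \in s -> J f,
        forall f, f \in s -> exists d, f \is d.-homog
      & regular_seq (fun f => f = 0) s].
Proof.
elim: n c J => [|n IH] [|c] J hJ Jhom // cn Jdim; try by exists [::]; split.
(* If J = 0, a chain of length n + 1 contradicts the bound. *)
have [[f [Jf f0]]|J0] := pselect (exists f, J f /\ f <> 0); last first.
  have [P [hP Pinc]] := zero_chain n.+1.
  suff /Jdim : prime_chain_over J n.+1 P by rewrite subSS leqNgt ltnS leq_subr.
  split=> // i im.
  have [hPi P0] := hP i im; split=> // x Jx; apply: P0.
  by apply: contrapT => x0; apply: J0; exists x.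
have [d ad0] : exists d, pihomog mdeg d f != 0.
  apply: contrapT => h; apply: f0.
  rewrite (@pihomog_partitionE _ _ mdeg (mmeasure mdeg f) f) // big1 // => i _.
  by apply/eqP/contraT => hi; case: h; exists (val i).
pose a := pihomog mdeg d f.
have Ja : J a by apply: Jhom.
have ha : a \is d.-homog by apply: pihomogP.
have [q [e [q0 e0 mob]]] := exists_shear hk ad0 ha.
pose r i := - q i.
have sK : cancel (comp_mpoly (shear q)) (comp_mpoly (shear r)) by apply: shearK.
have tK : cancel (comp_mpoly (shear r)) (comp_mpoly (shear q)).
  by apply: shearK; rewrite /r ?q0 ?oppr0 // => i; rewrite opprK.
pose phi : {rmorphism {mpoly k[n.+1]} -> {poly {mpoly k[n]}}} :=
  @muni n k \o comp_mpoly (shear q).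
pose psi : {rmorphism {poly {mpoly k[n]}} -> {mpoly k[n.+1]}} :=
  comp_mpoly (shear r) \o @muni_inv n.
have phiK : cancel phi psi by move=> x; rewrite /phi /psi /= muniK sK.
have psiK : cancel psi phi by move=> x; rewrite /phi /psi /= tK muni_invK.
(* K is J in the sheared coordinates, as an ideal of A[X] with A = k[x_1, ..., x_n]; b is its monic
   element. *)
pose K p := J (psi p); pose b := phi (e *: a).
have hK : ideal K by apply: ideal_comap.
have Kb : K b by rewrite /K /b phiK -mul_mpolyC; apply: idealM.
(* F preserves degrees, so the contraction of K to A is again stable under homogeneous components
   and F carries forms back to forms. *)
pose F : {additive {mpoly k[n]} -> {mpoly k[n.+1]}} := psi \o polyC.
have FE g : F g = (mwiden g) \mPo shear r by rewrite /F /psi /= muni_invC.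
have hF i g : g \is i.-homog -> F g \is i.-homog.
  by move=> hg; rewrite FE; apply/shear_homog/mwiden_homog.
have [|i g|||s [ss sJ shom sreg]] := IH c (fun g => K g%:P).
- exact: (ideal_comap polyC).
- rewrite /K -![psi _%:P]/(F _) => hg.
  by rewrite -pihomog_additive //; apply: Jhom.
- by [].
- move=> m P hP; have [Q [hQ _]] := going_up hK mob Kb hP.
  rewrite -subSS; apply: (Jdim m (fun i x => Q i (phi x))).
  by apply: prime_chain_comap psiK _ hQ => x Jx; rewrite /K phiK.
have psib : psi b = e *: a by rewrite /b phiK.
exists (map psi (b :: map polyC s)); split.
- by rewrite /= !size_map ss.
- move=> _ /mapP [x + ->]; rewrite inE => /orP [/eqP -> //|/mapP [y ys ->]].
  exact: sJ.
- move=> _ /mapP [x + ->]; rewrite inE => /orP [/eqP ->|/mapP [y ys ->]].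
    by exists d; rewrite psib; apply: rpredZ.
  by have [i hi] := shom y ys; exists i; apply: hF.
have -> : (fun f : {mpoly k[n.+1]} => f = 0) = (fun f => phi f = 0).
  apply/funext => x; apply/propext; split=> [->|]; first by rewrite rmorph0.
  by move=> h; apply: (can_inj phiK); rewrite h rmorph0.
apply: (@regular_seq_iso _ _ phi psi (fun p => p = 0)) => //.
by rewrite -map_comp (eq_map psiK) map_id; apply: regular_seq_monic.
Qed.

End MPoly.

(** * Dimensions of graded pieces *)

Section Dimension.
Variables (k : fieldType) (n : nat).

(* A module over the polynomial ring is seen as a k-vector space through the
   constant polynomials. *)
Section OneModule.
Variable V : lmodType {mpoly k[n]}.
Implicit Types (U N P : V -> Prop).

Definition lincomb m (b : 'I_m -> V) (c : 'rV[k]_m) : V :=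
  \sum_i (c 0 i)%:MP *: b i.

Definition subspace U : Prop :=
  U 0 /\ forall c v w, U v -> U w -> U (c%:MP *: v + w).

(** Convertible to [hilbert_fun] when U is a graded piece of the free module and N the relations; N
    need not lie in U. *)
Definition qdim U N m : Prop := exists b : 'I_m -> V,
  (forall i, U (b i)) /\ (forall v, U v -> exists! c, N (v - lincomb b c)).

Definition fdim U m : Prop := qdim U (fun v => v = 0) m.

Lemma lincombP m (b : 'I_m -> V) x c c' :
  lincomb b (x *: c + c') = x%:MP *: lincomb b c + lincomb b c'.
Proof.
rewrite /lincomb scaler_sumr -big_split; apply: eq_bigr => i _ /=.
by rewrite !mxE mpolyCD mpolyCM scalerDl scalerA.
Qed.

Lemma lincomb0 m (b : 'I_m -> V) : lincomb b 0 = 0.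
Proof. by rewrite /lincomb big1 // => i _; rewrite mxE scale0r. Qed.

Lemma lincombB m (b : 'I_m -> V) c c' :
  lincomb b (c - c') = lincomb b c - lincomb b c'.
Proof.
have -> : c - c' = -1 *: c' + c by rewrite scaleN1r addrC.
by rewrite lincombP mpolyCN mpolyC1 scaleN1r addrC.
Qed.

Lemma lincomb_row_mx a m (b : 'I_a -> V) (b' : 'I_m -> V) c c' :
  lincomb (fun i => match split i with inl j => b j | inr j => b' j end) (row_mx c c')
  = lincomb b c + lincomb b' c'.
Proof.
rewrite /lincomb big_split_ord /=; congr (_ + _); apply: eq_bigr => i _.
  by rewrite row_mxEl (unsplitK (inl i)).
by rewrite row_mxEr (unsplitK (inr i)).
Qed.

Lemma subspaceD U v w : subspace U -> U v -> U w -> U (v + w).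
Proof. by case=> _ hU Uv Uw; have := hU 1 v w Uv Uw; rewrite mpolyC1 scale1r. Qed.

Lemma subspaceZ U c v : subspace U -> U v -> U (c%:MP *: v).
Proof. by case=> U0 hU Uv; rewrite -[_ *: _]addr0; apply: hU. Qed.

Lemma subspaceB U v w : subspace U -> U v -> U w -> U (v - w).
Proof.
move=> hU Uv Uw; have := subspaceD hU Uv (subspaceZ (-1) hU Uw).
by rewrite mpolyCN mpolyC1 scaleN1r.
Qed.

Lemma subspaceI U N : subspace U -> subspace N -> subspace (fun v => U v /\ N v).
Proof.
move=> [U0 hU] [N0 hN]; split=> // c v w [Uv Nv] [Uw Nw].
by split; [apply: hU | apply: hN].
Qed.

Lemma subspace_lincomb U m (b : 'I_m -> V) c : subspace U ->
  (forall i, U (b i)) -> U (lincomb b c).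
Proof.
move=> hU Ub; rewrite /lincomb; elim/big_rec: _ => [|i v _ Uv]; first by case: hU.
by case: hU => _; apply.
Qed.

Lemma subspace0 : subspace (fun v : V => v = 0).
Proof. by split=> // c v w -> ->; rewrite scaler0 addr0. Qed.

Lemma qdimP U N m : subspace U -> subspace N ->
  qdim U N m <-> exists b : 'I_m -> V, [/\ forall i, U (b i),
    forall c, N (lincomb b c) -> c = 0 & forall v, U v -> exists c, N (v - lincomb b c)].
Proof.
move=> hU hN; split=> [] [b].
  case=> Ub hb; exists b; split=> // [c Nc|v /hb [c [Nc _]]]; last by exists c.
  have [c0 [_ uniq]] := hb _ hU.1; rewrite -(uniq 0); last first.
    by rewrite lincomb0 subr0; apply: hN.1.
  symmetry; apply: uniq; rewrite sub0r -sub0r; apply: subspaceB => //; exact: hN.1.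
move=> [Ub bfree bspan]; exists b; split=> // v /bspan [c Nc]; exists c; split=> // c' Nc'.
apply/eqP; rewrite -subr_eq0; apply/eqP/bfree; rewrite lincombB.
have -> : lincomb b c - lincomb b c' = (v - lincomb b c') - (v - lincomb b c).
  by rewrite opprB [RHS]addrC addrA subrK.
exact: subspaceB.
Qed.

Lemma fdimP U m : subspace U ->
  fdim U m <-> exists b : 'I_m -> V, [/\ forall i, U (b i),
    forall c, lincomb b c = 0 -> c = 0 & forall v, U v -> exists c, v = lincomb b c].
Proof.
move=> hU; rewrite /fdim qdimP //; last exact: subspace0.
split=> [] [b [Ub bfree bspan]]; exists b; split=> // v /bspan [c hc]; exists c.
  by apply/eqP; rewrite -subr_eq0; apply/eqP.
by rewrite hc subrr.
Qed.

Lemma free_le_span m m' (b : 'I_m -> V) (b' : 'I_m' -> V) :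
  (forall c, lincomb b c = 0 -> c = 0) -> (forall i, exists c, b i = lincomb b' c) ->
  (m <= m')%N.
Proof.
move=> bfree /choice [f hf]; pose A := \matrix_i f i.
have AE c : lincomb b' (c *m A) = lincomb b c.
  rewrite mulmx_sum_row /lincomb.
  transitivity (\sum_i (c 0 i)%:MP *: b i); last by [].
  under [RHS]eq_bigr => i _ do rewrite hf /lincomb scaler_sumr.
  rewrite exchange_big; apply: eq_bigr => j _ /=.
  rewrite summxE rmorph_sum scaler_suml; apply: eq_bigr => i _.
  by rewrite /= !mxE mpolyCM scalerA.
have : row_free A.
  rewrite -kermx_eq0; apply/eqP/row_matrixP => i; rewrite row0; apply: bfree.
  by rewrite -AE -row_mul mulmx_ker row0 lincomb0.
by rewrite /row_free => /eqP <-; apply: rank_leq_col.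
Qed.

Lemma fdim_le U P m p : subspace U -> subspace P -> (forall v, U v -> P v) ->
  fdim U m -> fdim P p -> (m <= p)%N.
Proof.
move=> hU hP UP /(fdimP _ hU) [b [Ub bfree _]] /(fdimP _ hP) [b' [_ _ bspan]].
by apply: free_le_span bfree _ => i; apply/bspan/UP.
Qed.

Lemma fdim_uniq U m p : subspace U -> fdim U m -> fdim U p -> m = p.
Proof.
move=> hU hm hp; apply/eqP; rewrite eqn_leq.
by rewrite (fdim_le hU hU _ hm hp) // (fdim_le hU hU _ hp hm).
Qed.

(** If U had no finite basis, every free family in U could be extended by one vector, eventually
    beyond the dimension of P. *)
Lemma fdim_sub U P p : subspace U -> subspace P -> (forall v, U v -> P v) ->
  fdim P p -> exists m, fdim U m.
Proof.
move=> hU hP UP /(fdimP _ hP) [b' [_ _ bspan]].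
apply: contrapT => noU.
suff big m : exists b : 'I_m -> V,
    (forall i, U (b i)) /\ forall c, lincomb b c = 0 -> c = 0.
  have [b [Ub bfree]] := big p.+1; suff : (p < p)%N by rewrite ltnn.
  by apply: free_le_span bfree _ => i; apply/bspan/UP.
elim: m => [|m [b [Ub bfree]]].
  by exists (fun _ => 0); split=> [[]//|c _]; apply/rowP => [[]].
have [v [Uv hv]] : exists v, U v /\ ~ exists c, v = lincomb b c.
  apply: contrapT => h; apply: noU; exists m; apply/fdimP => //; exists b; split=> // v Uv.
  by apply: contrapT => hv; apply: h; exists v.
rewrite -addn1; exists (fun i => match split i with inl j => b j | inr _ => v end).
split=> [i|c]; first by case: (split i).
rewrite -[c]hsubmxK lincomb_row_mx; set l := lsubmx c; set r := rsubmx c.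
have -> : lincomb (fun=> v) r = (r 0 0)%:MP *: v by rewrite /lincomb big_ord1.
have [r0|r0] := eqVneq (r 0 0) 0.
  rewrite r0 mpolyC0 scale0r addr0 => /bfree ->.
  rewrite (_ : r = 0) ?row_mx0 //; apply/rowP => i; by rewrite !ord1 r0 mxE.
move=> E; case: hv; exists (- (r 0 0)^-1 *: l).
rewrite -[_ *: l]addr0 lincombP lincomb0 addr0.
move/eqP: E; rewrite addr_eq0 => /eqP ->.
by rewrite scalerN -scaleNr scalerA -mpolyCN -mpolyCM opprK mulVf // mpolyC1 scale1r.
Qed.

Lemma fdim_qdim U N a m : subspace U -> subspace N ->
  fdim (fun v => U v /\ N v) a -> qdim U N m -> fdim U (a + m).
Proof.
move=> hU hN /(fdimP _ (subspaceI hU hN)) [b [UNb bfree bspan]].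
move=> /(qdimP _ hU hN) [b' [Ub' bfree' bspan']].
apply/fdimP => //; exists (fun i => match split i with inl j => b j | inr j => b' j end).
split=> [i|c|v Uv]; first by case: (split i) => // j; have [] := UNb j.
  rewrite -[c]hsubmxK lincomb_row_mx => E.
  have r0 : rsubmx c = 0.
    apply: bfree'; move/eqP: E; rewrite addrC addr_eq0 => /eqP ->; rewrite -sub0r.
    apply: subspaceB => //; first exact: hN.1.
    by apply: subspace_lincomb => // i; have [] := UNb i.
  move: E; rewrite r0 lincomb0 addr0 => /bfree ->; exact: row_mx0.
have [c' Nc'] := bspan' v Uv.
have [c Ec] : exists c, v - lincomb b' c' = lincomb b c.
  by apply: bspan; split=> //; apply: subspaceB => //; apply: subspace_lincomb.
by exists (row_mx c c'); rewrite lincomb_row_mx -Ec subrK.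
Qed.

Lemma fdim_zero : fdim (fun v : V => v = 0) 0.
Proof.
apply/fdimP; first exact: subspace0.
exists (fun _ => 0); split=> // [c _|v ->]; first by apply/rowP => [[]].
by exists 0; rewrite lincomb0.
Qed.

End OneModule.

Section Morphism.
Variables (V W : lmodType {mpoly k[n]}) (U : V -> Prop) (f : V -> W).
Hypotheses (hU : subspace U)
  (fP : forall c v w, U v -> U w -> f (c%:MP *: v + w) = c%:MP *: f v + f w).

Let f0 : f 0 = 0.
Proof.
have := fP (-1) hU.1 hU.1.
by rewrite scaler0 addr0 mpolyCN mpolyC1 scaleN1r addNr.
Qed.

Lemma subspace_morph : subspace (fun w => exists2 v, U v & f v = w).
Proof.
split; first by exists 0 => //; apply: hU.1.
move=> c _ _ [v Uv <-] [w Uw <-]; exists (c%:MP *: v + w); last exact: fP.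
by apply: hU.2.
Qed.

Lemma lincomb_morph p (b : 'I_p -> V) c :
  (forall i, U (b i)) -> f (lincomb b c) = lincomb (f \o b) c.
Proof.
move=> Ub; suff [] : U (lincomb b c) /\ f (lincomb b c) = lincomb (f \o b) c by [].
rewrite /lincomb; elim/big_rec2: _ => [|i x y _ [Uy fy]]; first by split; [apply: hU.1|].
by split; [apply: hU.2 | rewrite fP // fy].
Qed.

(** Rank-nullity. Linearity is assumed on U only, because the map phi of [bourbaki_ideal] is
    controlled on syzygies only. *)
Lemma fdim_exact a m : fdim (fun v => U v /\ f v = 0) a ->
  fdim (fun w => exists2 v, U v & f v = w) m -> fdim U (a + m).
Proof.
have hI := subspace_morph; have flin := lincomb_morph.
have hK : subspace (fun v => U v /\ f v = 0).
  split=> [|c v w [Uv fv] [Uw fw]]; first by split=> //; apply: hU.1.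
  by split; [apply: hU.2 | rewrite fP // fv fw scaler0 addr0].
move=> /(fdimP _ hK) [b [UNb bfree bspan]] /(fdimP _ hI) [b' [Ib' bfree' bspan']].
have /choice [g hg] : forall i, exists v, U v /\ f v = b' i.
  by move=> i; have [v] := Ib' i; exists v.
have Ug i : U (g i) by have [] := hg i.
have fg : f \o g = b' by apply/funext => i; have [] := hg i.
apply/fdimP => //; exists (fun i => match split i with inl j => b j | inr j => g j end).
have Ub i : U (b i) by have [] := UNb i.
split=> [i|c|v Uv]; first by case: (split i).
  rewrite -[c]hsubmxK lincomb_row_mx => E.
  have r0 : rsubmx c = 0.
    apply: bfree'; rewrite -fg -flin //.
    have [Ul fl] := subspace_lincomb (lsubmx c) hK UNb.
    have := fP (-1) Ul hU.1; rewrite addr0 f0 addr0 fl scaler0.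
    move/eqP: E; rewrite addrC addr_eq0 => /eqP ->.
    by rewrite mpolyCN mpolyC1 scaleN1r.
  move: E; rewrite r0 lincomb0 addr0 => /bfree ->; exact: row_mx0.
have [c' Ec'] : exists c', f v = lincomb b' c' by apply: bspan'; exists v.
have Ugc' : U (lincomb g c') by apply: subspace_lincomb.
have [c Ec] : exists c, v - lincomb g c' = lincomb b c.
  apply: bspan; split; first exact: subspaceB.
  rewrite addrC -scaleN1r -mpolyC1 -mpolyCN fP // flin // fg -Ec'.
  by rewrite mpolyCN mpolyC1 scaleN1r addNr.
by exists (row_mx c c'); rewrite lincomb_row_mx -Ec subrK.
Qed.

End Morphism.

End Dimension.

(** * Homogeneous components in integer degrees *)

Section Graded.
Variables (k : fieldType) (n : nat).
Local Notation R := {mpoly k[n]}.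
Implicit Types (t r : int) (p z : R).

Definition pihomogz t p : R :=
  if t is Posz d then pihomog mdeg d p else 0.

Lemma pihomogz_is_linear t : linear (pihomogz t).
Proof.
case: t => d c p q /=; first exact: linearP.
by rewrite scaler0 addr0.
Qed.

HB.instance Definition _ t :=
  GRing.isLinear.Build k R R _ (pihomogz t) (pihomogz_is_linear t).

Arguments pihomogz : simpl never.

Lemma pihomogzP t p : homogz t (pihomogz t p).
Proof. by case: t => d; rewrite /pihomogz //=; apply: pihomogP. Qed.

Lemma pihomogz_id t p : homogz t p -> pihomogz t p = p.
Proof. by case: t => d /= hp; rewrite /pihomogz ?hp // pihomog_dE. Qed.

(** Turns homogeneity into a fixed-point equation for a linear map, uniformly in negative degrees
    too. *)
Lemma homogzE t p : homogz t p <-> pihomogz t p = p.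
Proof. by split=> [/pihomogz_id//|<-]; apply: pihomogzP. Qed.

Lemma pihomogz_ne t r p : homogz t p -> t != r -> pihomogz r p = 0.
Proof.
case: t => d; last by move=> -> _; apply: raddf0.
case: r => e //= hp de; rewrite /pihomogz.
by apply: pihomog_ne0 hp; apply: contra_neq de => ->.
Qed.

Lemma homogz_partition p : exists N, p = \sum_(i < N) pihomogz (val i)%:Z p.
Proof. by exists (mmeasure mdeg p); rewrite /= -pihomog_partitionE. Qed.

Lemma pihomogz_mul t r a z : homogz r a ->
  pihomogz t (a * z) = a * pihomogz (t - r) z.
Proof.
case: r => d; last by move=> ->; rewrite !mul0r raddf0.
move=> ha; have [N zE] := homogz_partition z; rewrite {1 2}zE mulr_sumr.
rewrite !raddf_sum mulr_sumr; apply: eq_bigr => i _.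
rewrite /=; have hi := pihomogzP (val i)%:Z z; set u := pihomogz _ z in hi *.
have hau : homogz (d + val i)%N%:Z (a * u) by apply: dhomogM ha hi.
have [->|ti] := eqVneq t (d + val i)%N%:Z.
  rewrite PoszD addrAC subrr add0r.
  by rewrite !pihomogz_id // -PoszD.
rewrite !(@pihomogz_ne _ _ _ hau) ?(@pihomogz_ne _ _ _ hi) ?mulr0 //.
- by apply: contra_neq ti => ti; rewrite PoszD ti addrC subrK.
- by rewrite eq_sym.
Qed.

Lemma homogz_mul t r a z : homogz r a -> homogz t z -> homogz (r + t) (a * z).
Proof.
move=> ha hz; apply/homogzE; rewrite (pihomogz_mul _ _ ha).
by rewrite addrAC subrr add0r pihomogz_id.
Qed.

Lemma homogz_cancel t r a z : a != 0 -> homogz r a -> homogz t (a * z) ->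
  homogz (t - r) z.
Proof.
move=> a0 ha /homogzE; rewrite (pihomogz_mul _ _ ha) => /(mulfI a0) E.
by apply/homogzE.
Qed.

Lemma subspace_homogz t : subspace (homogz t : R^o -> Prop).
Proof.
split; first by apply/homogzE; rewrite raddf0.
move=> c v w /homogzE hv /homogzE hw; apply/homogzE.
by rewrite [_ *: _]mul_mpolyC linearP /= hv hw.
Qed.

(* dim_k R_t, correct for 0 < n only. *)
Definition hdim t : nat := if t is Posz d then 'C(d + n.-1, d) else 0%N.

Lemma fdim_homogz t : (0 < n)%N -> fdim (homogz t : R^o -> Prop) (hdim t).
Proof.
move=> n0; case: t => [d|d] /=; last exact: fdim_zero.
apply/fdimP; first exact: (subspace_homogz (Posz d)).
case: n n0 => // n' _; have [f flin [g gK fK]] := dhomog_vecaxiom n' k d.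
have fP c (p q : dhomog n'.+1 k d) : f (c *: p + q) = c *: f p + f q by apply: flin.
have gP c u v : g (c *: u + v) = c *: g u + g v.
  by apply: (can_inj gK); rewrite fP !fK.
pose G u : {mpoly k[n'.+1]} := g u.
have GD u v : G (u + v) = G u + G v.
  by have := congr1 val (gP 1 u v); rewrite !scale1r.
have G0 : G 0 = 0 by have /esym/eqP := GD 0 0; rewrite addr0 -subr_eq0 addrK => /eqP.
have GZ c u : G (c *: u) = c *: G u.
  by have := congr1 val (gP c u 0); rewrite addr0 /= -/(G 0) G0 addr0.
have GE c : lincomb (fun i => G (delta_mx 0 i) : {mpoly k[n'.+1]}^o) c = G c.
  rewrite [in RHS](row_sum_delta c) (big_morph G GD G0); apply: eq_bigr => i _.
  by rewrite GZ [LHS]mul_mpolyC.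
exists (fun i => G (delta_mx 0 i)); split=> [i|c|v hv].
- exact: dhomog_is_dhomog.
- rewrite GE => Gc; apply: (can_inj fK); apply/val_inj.
  by rewrite /= -[LHS]/(G c) -[RHS]/(G 0) Gc G0.
- by exists (f (DHomog hv)); rewrite GE /G gK.
Qed.

Section Vectors.
Variables (p : nat) (a : 'I_p -> int).

Definition hcomp t (v : 'cV[R]_p) : 'cV[R]_p := \col_i pihomogz (t - a i) (v i 0).

Lemma hcompP t v : homog_vec a t (hcomp t v).
Proof. by move=> i; rewrite mxE; apply: pihomogzP. Qed.

Lemma hcomp_id t v : homog_vec a t v -> hcomp t v = v.
Proof.
by move=> hv; apply/matrixP => i j; rewrite mxE ord1 pihomogz_id //; apply: hv.
Qed.

Lemma subspace_homog_vec t : subspace (homog_vec a t : 'cV[R]_p -> Prop).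
Proof.
split=> [i|c v w hv hw i]; rewrite !mxE; first exact: (subspace_homogz _).1.
exact: (subspace_homogz _).2.
Qed.

Lemma fdim_homog_vec t : (0 < n)%N ->
  fdim (homog_vec a t : 'cV[R]_p -> Prop) (\sum_i hdim (t - a i))%N.
Proof.
move=> n0.
(* The vectors supported on the first j coordinates; the dimension is built up by projecting onto
   one more coordinate at a time. *)
pose U j (v : 'cV[R]_p) := homog_vec a t v /\ forall i : 'I_p, (j <= i)%N -> v i 0 = 0.
have hU j : subspace (U j).
  apply: subspaceI; first exact: subspace_homog_vec.
  split=> [i _|c v w hv hw i ji]; first by rewrite mxE.
  by rewrite !mxE hv // hw // mulr0 addr0.
suff h j : (j <= p)%N -> fdim (U j) (\sum_(i < p | (i < j)%N) hdim (t - a i))%N.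
  rewrite (eq_bigl (fun i : 'I_p => (i < p)%N)); last by move=> i; rewrite ltn_ord.
  have := h p (leqnn p).
  suff -> : U p = homog_vec a t by [].
  apply/funext => v; apply/propext; split=> [[]//|hv]; split=> // i.
  by rewrite leqNgt ltn_ord.
elim: j => [|j IH] jp.
  rewrite big_pred0 //; suff -> : U 0%N = fun v => v = 0 by apply: fdim_zero.
  apply/funext => v; apply/propext; split=> [[_ v0]|->].
    by apply/matrixP => i l; rewrite ord1 mxE v0.
  by split=> [i|i _]; rewrite mxE //; apply: (subspace_homogz _).1.
pose o := Ordinal jp.
have -> : (\sum_(i < p | (i < j.+1)%N) hdim (t - a i) =
          \sum_(i < p | (i < j)%N) hdim (t - a i) + hdim (t - a o))%N.
  rewrite (bigD1 o) /= ?ltnSn // addnC; congr (_ + _)%N; apply: eq_bigl => i.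
  by rewrite ltnS [in RHS]ltn_neqAle andbC.
refine (@fdim_exact k n _ (R^o) (U j.+1) (fun v => v o 0) _ _ _ _ _ _); first exact: hU.
- by move=> c v w _ _; rewrite !mxE.
- suff -> : (fun v => U j.+1 v /\ v o 0 = 0) = U j by apply/IH/ltnW.
  apply/funext => v; apply/propext; split.
    case=> [[hv v0] vo]; split=> // i; rewrite leq_eqVlt => /orP [/eqP ji|]; last exact: v0.
    by rewrite (_ : i = o) //; apply/val_inj.
  case=> hv v0; split; last exact: v0.
  by split=> // i ji; apply/v0/ltnW.
- suff -> : (fun w : R^o => exists2 v, U j.+1 v & v o 0 = w) = homogz (t - a o).
    exact: fdim_homogz.
  apply/funext => w; apply/propext; split=> [[v [hv _] <-]//|hw].
  exists (w *: delta_mx o 0); last by rewrite !mxE !eqxx mulr1.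
  split=> i; rewrite !mxE andbT; last first.
    by move=> ji; rewrite (_ : i == o = false) ?mulr0 // eqE /= gtn_eqF.
  case: eqVneq => [->|_]; first by rewrite mulr1.
  by rewrite mulr0; apply: (subspace_homogz _).1.
Qed.

End Vectors.

Section GradedMatrix.
Variables (p q : nat) (a : 'I_p -> int) (b : 'I_q -> int) (A : 'M[R]_(p, q)).
Hypothesis hA : graded_mx a b A.

Lemma hcomp_mul t (v : 'cV[R]_q) : hcomp a t (A *m v) = A *m hcomp b t v.
Proof.
apply/matrixP => i j; rewrite mxE !mxE raddf_sum; apply: eq_bigr => l _.
rewrite /= (pihomogz_mul _ _ (hA i l)) ord1 mxE; congr (_ * pihomogz _ _).
by ring.
Qed.

Lemma homog_vec_mul t (v : 'cV[R]_q) : homog_vec b t v -> homog_vec a t (A *m v).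
Proof. by move=> hv; rewrite -(hcomp_id hv) -hcomp_mul; apply: hcompP. Qed.

(** A homogeneous element of the image has a homogeneous preimage: the component of the same degree
    of any preimage. *)
Lemma graded_image t :
  (fun w => homog_vec a t w /\ exists v, w = A *m v) =
  (fun w => exists2 v, homog_vec b t v & A *m v = w).
Proof.
apply/funext => w; apply/propext; split=> [[hw [v wE]]|[v hv <-]].
  by exists (hcomp b t v); [apply: hcompP | rewrite -hcomp_mul -wE hcomp_id].
by split; [apply: homog_vec_mul | exists v].
Qed.

Lemma fdim_graded t i j : (0 < n)%N ->
  fdim (fun v => homog_vec b t v /\ A *m v = 0) i ->
  fdim (fun w => homog_vec a t w /\ exists v, w = A *m v) j ->
  (\sum_l hdim (t - b l) = i + j)%N.
Proof.
move=> n0 hi hj; apply: (fdim_uniq (subspace_homog_vec b t)).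
  exact: fdim_homog_vec.
apply: (@fdim_exact _ _ _ _ _ (mulmx A)) hi _; first exact: subspace_homog_vec.
  by move=> c v w _ _; rewrite mulmxDr -scalemxAr.
by rewrite -graded_image.
Qed.

Lemma subspace_ker t : subspace (fun v => homog_vec b t v /\ A *m v = 0).
Proof.
apply: subspaceI; first exact: subspace_homog_vec.
split=> [|c v w hv hw]; first by rewrite mulmx0.
by rewrite mulmxDr -scalemxAr hv hw scaler0 addr0.
Qed.

Lemma subspace_image t : subspace (fun w => homog_vec a t w /\ exists v, w = A *m v).
Proof.
apply: subspaceI; first exact: subspace_homog_vec.
split=> [|c _ _ [v ->] [w ->]]; first by exists 0; rewrite mulmx0.
by exists (c%:MP *: v + w); rewrite mulmxDr -scalemxAr.
Qed.

Lemma fdim_ker t : (0 < n)%N ->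
  exists i, fdim (fun v => homog_vec b t v /\ A *m v = 0) i.
Proof.
move=> n0; apply: fdim_sub (fdim_homog_vec b t n0); first exact: subspace_ker.
  exact: subspace_homog_vec.
by move=> v [].
Qed.

Lemma fdim_image t : (0 < n)%N ->
  exists i, fdim (fun w => homog_vec a t w /\ exists v, w = A *m v) i.
Proof.
move=> n0; apply: fdim_sub (fdim_homog_vec a t n0); first exact: subspace_image.
  exact: subspace_homog_vec.
by move=> v [].
Qed.

Lemma hilbert_fun_gcoker t m i : (0 < n)%N ->
  hilbert_fun (gcoker a A) t m ->
  fdim (fun v => homog_vec b t v /\ A *m v = 0) i ->
  (m + \sum_l hdim (t - b l) = i + \sum_l hdim (t - a l))%N.
Proof.
move=> n0 hm hi; have [j hj] := fdim_image t n0.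
rewrite (fdim_graded n0 hi hj).
have hN : subspace (fun w : 'cV[R]_p => exists v, w = A *m v).
  split=> [|c _ _ [v ->] [w ->]]; first by exists 0; rewrite mulmx0.
  by exists (c%:MP *: v + w); rewrite mulmxDr -scalemxAr.
have := fdim_qdim (subspace_homog_vec a t) hN hj hm.
move=> /(fdim_uniq (subspace_homog_vec a t) (fdim_homog_vec a t n0)) ->; lia.
Qed.

End GradedMatrix.
End Graded.

Arguments pihomogz {k n} t p : simpl never.

(** * Hilbert polynomials *)

Section Numerical.
Implicit Types (p q : {poly rat}).

Lemma eventually_poly_eq p q t0 :
  (forall t : nat, (t0 <= t)%N -> p.[t%:R] = q.[t%:R]) -> p = q.
Proof.
move=> h; apply/eqP; rewrite -subr_eq0; apply/contraT => pq0.
pose rs := [seq (t0 + i)%:R | i <- iota 0 (size (p - q))] : seq rat.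
have : (size rs < size (p - q)%R)%N.
  apply: max_poly_roots => //.
    apply/allP => _ /mapP [i _ ->].
    by rewrite /root hornerD hornerN h ?subrr // leq_addr.
  rewrite map_inj_uniq ?iota_uniq // => i j /eqP.
  by rewrite eqr_nat eqn_add2l => /eqP.
by rewrite size_map size_iota ltnn.
Qed.

Lemma eventually_ge0_lead_coef p t0 :
  (forall t : nat, (t0 <= t)%N -> 0 <= p.[t%:R]) -> 0 <= lead_coef p.
Proof.
move=> h; rewrite leNgt; apply/negP => lp.
have [|x hx] := @poly_pinfty_gt_lc _ (- p); first by rewrite lead_coefN oppr_gt0.
pose t := maxn t0 (Num.bound `|x|).
have xt : x <= t%:R.
  apply: le_trans (ler_norm x) _; apply: le_trans (ltW (archi_boundP (normr_ge0 x))) _.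
  by rewrite ler_nat leq_maxr.
have := hx _ xt; rewrite hornerN lead_coefN lerN2 => h1.
have := h t (leq_maxl _ _).
by rewrite leNgt (le_lt_trans h1 lp).
Qed.

(** If p had larger degree than q, then p and q - p would have opposite leading coefficients, both
    nonnegative. *)
Lemma eventually_bounded_coef p q t0 i : (size q <= i)%N ->
  (forall t : nat, (t0 <= t)%N -> 0 <= p.[t%:R] <= q.[t%:R]) -> p`_i = 0.
Proof.
move=> qi h; apply: nth_default; apply: leq_trans qi.
rewrite leqNgt; apply/negP => qp.
have l1 : 0 <= lead_coef p.
  by apply: (@eventually_ge0_lead_coef _ t0) => t /h /andP [].
have l2 : 0 <= lead_coef (q - p).
  apply: (@eventually_ge0_lead_coef _ t0) => t /h /andP [_].
  by rewrite hornerD hornerN subr_ge0.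
move: l2; rewrite lead_coefDr ?size_polyN // lead_coefN oppr_ge0 => l2.
have : lead_coef p == 0 by rewrite eq_le l1 l2.
by rewrite lead_coef_eq0 => /eqP p0; move: qp; rewrite p0 size_poly0.
Qed.

Definition shiftp (a : rat) p : {poly rat} := p \Po ('X + a%:P).

Lemma shiftp_eval a p x : (shiftp a p).[x] = p.[x + a].
Proof. by rewrite horner_comp hornerD hornerX hornerC. Qed.

(* Taylor expansion at a. *)
Lemma coef_shiftp a p j : (shiftp a p)`_j = p^`N(j).[a].
Proof.
rewrite /shiftp /comp_poly addrC nderiv_taylor; last by rewrite /GRing.comm mulrC.
under eq_bigr => i _ do rewrite nderivn_map horner_map mul_polyC.
rewrite -(poly_def _ (fun i => p^`N(i).[a])) coef_poly size_map_polyC.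
case: ltnP => // pj; rewrite (_ : p^`N(j) = 0) ?horner0 //.
apply/polyP => i; rewrite coef_nderivn coef0 nth_default ?mul0rn //.
by rewrite (leq_trans pj) // leq_addr.
Qed.

(** With n = N + 3 variables, the Hilbert polynomial of R has degree N + 2, and e_0 and e_1 sit in
    degrees N + 1 and N; hence three coefficients. *)
Lemma coef_shiftp_top a p N : (size p <= N.+3)%N ->
  [/\ (shiftp a p)`_N.+2 = p`_N.+2,
      (shiftp a p)`_N.+1 = p`_N.+1 + N.+2%:R * a * p`_N.+2
    & (shiftp a p)`_N = p`_N + N.+1%:R * a * p`_N.+1
        + N.+2%:R * N.+1%:R / 2 * a ^+ 2 * p`_N.+2].
Proof.
move=> pN.
have E j d : (N.+3 <= j + d)%N ->
    (shiftp a p)`_j = \sum_(i < d) p`_(j + i) *+ 'C(j + i, j) * a ^+ i.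
  move=> jd; rewrite coef_shiftp (@horner_coef_wide _ d).
    by apply: eq_bigr => i _; rewrite coef_nderivn.
  apply/leq_sizeP => i di; rewrite coef_nderivn nth_default ?mul0rn //.
  by apply: leq_trans pN (leq_trans jd _); rewrite leq_add2l.
split.
- by rewrite (E _ 1%N) ?addn1 // big_ord1 addn0 binn mulr1.
- rewrite (E _ 2%N) ?addn2 // big_ord_recl big_ord1 /= addn0 binn expr0 mulr1.
  by rewrite /bump /= addn1 expr1 binSn -[_ *+ N.+2]mulr_natr; ring.
- rewrite (E _ 3%N) ?addn3 // 2!big_ord_recl big_ord1 /= addn0 binn expr0 mulr1.
  rewrite /bump /= addn1 addn2 expr1 binSn -[_ *+ N.+1]mulr_natr -[_ *+ 'C(_, _)]mulr_natr.
  have -> : 'C(N.+2, N)%:R = N.+2%:R * N.+1%:R / 2 :> rat.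
    apply: (mulIf (_ : 2 != 0)) => //; rewrite divfK // -!natrM; congr (_%:R).
    have -> : 'C(N.+2, N) = 'C(N.+2, 2) by rewrite -(@bin_sub N.+2 2) // !subSS subn0.
    by have := bin_ffact N.+2 2; rewrite !ffactnS ffactn0 muln1.
  by ring.
Qed.

(* The Hilbert polynomial of the polynomial ring in N + 1 variables. *)
Definition binp N : {poly rat} := N`!%:R^-1 *: \prod_(i < N) ('X + i.+1%:R%:P).

Lemma binp_eval N (t : nat) : (binp N).[t%:R] = 'C(t + N, t)%:R.
Proof.
rewrite /binp hornerZ horner_prod.
have -> : \prod_(i < N) ('X + i.+1%:R%:P).[t%:R] = ((t + N) ^_ N)%:R :> rat.
  elim: N => [|N IH]; first by rewrite big_ord0 ffactn0.
  rewrite big_ord_recr /= IH addnS ffactSS hornerD hornerX hornerC -natrD addnS.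
  by rewrite mulrC -natrM.
rewrite -bin_ffact natrM mulrCA mulVf ?mulr1; last by rewrite pnatr_eq0 -lt0n fact_gt0.
by rewrite -(bin_sub (leq_addr N t)) addKn.
Qed.

(** The second coefficient comes from 1 + 2 + ... + (N + 2). The one in degree N is left unknown: it
    cancels later, since the shifts of [binp] are always combined with weights of sum zero. *)
Lemma binp_coef N : [/\ (size (binp N.+2) <= N.+3)%N, (binp N.+2)`_N.+2 = N.+2`!%:R^-1
  & (binp N.+2)`_N.+1 = N.+3%:R * N.+2%:R / 2 / N.+2`!%:R].
Proof.
pose P j : {poly rat} := \prod_(i < j.+1) ('X + i.+1%:R%:P).
have E j : [/\ (size (P j) <= j.+2)%N, (P j)`_j.+1 = 1
  & (P j)`_j = j.+2%:R * j.+1%:R / 2].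
  elim: j => [|j [IHs IH1 IH0]].
    rewrite /P big_ord1 size_XaddC; split=> //;
      by rewrite coefD coefX coefC ?addr0 ?add0r // divff.
  rewrite (_ : P j.+1 = P j * ('X + j.+2%:R%:P)); last by rewrite {1}/P big_ord_recr.
  split.
  - by rewrite (leq_trans (size_polyMleq _ _)) // size_XaddC addn2.
  - rewrite mulrDr coefD coefMX coefMC IH1 /= [(P j)`_j.+2]nth_default ?mul0r ?addr0 //.
  - rewrite mulrDr coefD coefMX coefMC IH1 IH0 /= mul1r.
    by rewrite -[j.+3%:R]natr1 -[j.+2%:R]natr1 -[j.+1%:R]natr1; field.
have [Es E1 E0] := E N.+1; rewrite /binp -/(P N.+1); split.
- by rewrite (leq_trans (size_scale_leq _ _)).
- by rewrite coefZ E1 mulr1.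
- by rewrite coefZ E0 mulrC.
Qed.

Lemma hdim_shift N (a : int) (t : nat) : 0 <= t%:Z + a ->
  (hdim N.+3 (t%:Z + a))%:R = (shiftp a%:~R (binp N.+2)).[t%:R] :> rat.
Proof.
rewrite shiftp_eval; case E : (t%:Z + a) => [u|u] // _ /=.
rewrite -binp_eval; congr (_.[_]).
by rewrite -[u%:R]/((u%:Z)%:~R) -E intrD.
Qed.

End Numerical.

(** * The Bourbaki degree *)

Section KrullDim.
Variables (k : fieldType) (n : nat).
Local Notation R := {mpoly k[n]}.

(** Allows J to replace the annihilator as soon as every prime containing J contains the
    annihilator; this is how the ideal of minors is brought in. *)
Lemma krull_dim_chain (M : gmod k n) r (J : R -> Prop) :
  krull_dim_le M r ->
  (forall P, prime_ideal P -> (forall x, J x -> P x) -> forall x, gann M x -> P x) ->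
  forall m P, prime_chain_over J m P -> (m <= r)%N.
Proof.
move=> hr hJ m P [hP Pinc]; pose Pb i : {pred R} := [pred x | `[< P i x >]].
have PbP i x : reflect (P i x) (x \in Pb i) by apply: asboolP.
apply: (hr m Pb); split=> i im.
  have [hPi JP] := hP i im; split.
  - split; first by apply/PbP; apply: (ideal0 hPi).
      by apply/PbP; apply: (prime_ideal1 hPi).
    move=> a u v /PbP hu /PbP hv; apply/PbP.
    by apply: (idealD hPi) => //; apply: (idealM hPi).
  - by move=> u v /PbP /(prime_idealM hPi) [] /PbP ->; rewrite ?orbT.
  - by move=> x /(hJ _ hPi JP) ?; apply/PbP.
have [PP [x Px nPx]] := Pinc i im; split; first by move=> y /PbP /PP h; apply/PbP.
by exists x; apply/PbP.
Qed.

Lemma krull_dim_uniq (M : gmod k n) d d' : krull_dim M d -> krull_dim M d' -> d = d'.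
Proof.
move=> [[P hP] hd] [[P' hP'] hd']; apply/eqP; rewrite eqn_leq.
by rewrite (hd' _ _ hP) (hd _ _ hP').
Qed.

Lemma gann_gquot (I : {pred R}) x : gann (gquot I) x -> x \in I.
Proof. by move=> /(_ (const_mx 1)) /=; rewrite !mxE mulr1. Qed.

Lemma ideal_pred (I : {pred R}) : idealr_closed I -> ideal (fun x => x \in I).
Proof.
case=> I0 _ hI; split=> // [x y hx hy|a x hx].
  by rewrite -[x]mul1r; apply: hI.
by rewrite -[_ * _]addr0; apply: hI.
Qed.

Definition regular_pair (a b : R) : Prop :=
  a != 0 /\ forall x y, b * x = a * y -> exists z, x = a * z.

Lemma homog_regular_pair (hk : infinite_field k) (I : {pred R}) : (2 <= n)%N ->
  idealr_closed I -> homog_ideal I -> krull_dim_le (gquot I) (n - 2) ->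
  exists a b (d e : nat), [/\ a \in I, b \in I, a \is d.-homog, b \is e.-homog
    & regular_pair a b].
Proof.
move=> n2 hI Ihom hdim.
have [|//||s [ss sI shom sreg]] :=
    @homog_regular_seq k hk n 2 (fun x => x \in I) (ideal_pred hI).
- by move=> d f; apply: Ihom.
- by apply: (krull_dim_chain hdim) => P hP IP x /gann_gquot /IP.
case: s ss sI shom sreg => [|a [|b []]] //= _ sI shom [ha [hb _]].
have [d hd] := shom a (mem_head _ _).
have bs : b \in [:: a; b] by rewrite !inE eqxx orbT.
have [e he] := shom b bs.
exists a, b, d, e; split=> //; [exact: sI (mem_head _ _)|exact: sI|split].
  apply/eqP => a0; move: (ha 1); rewrite a0 mul0r => /(_ erefl) /eqP.
  by rewrite oner_eq0.
move=> x y E; have [|z [c [-> ->]]] := hb x; last by exists c; rewrite add0r mulrC.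
by exists 0, y; rewrite add0r E mulrC.
Qed.

End KrullDim.

(** * Dimension counts for R/I and the Bourbaki sequence *)

Section HilbertCount.
Variables (k : fieldType) (n : nat) (n0 : (0 < n)%N).
Local Notation R := {mpoly k[n]}.

Definition ideal_part (I : {pred R}) (u : int) : 'cV[R]_1 -> Prop :=
  fun w => homog_vec (fun=> 0) u w /\ w 0 0 \in I.

Lemma subspace_ideal_part I u : idealr_closed I -> subspace (ideal_part I u).
Proof.
move=> hI; apply: subspaceI; first exact: subspace_homog_vec.
have hI' := ideal_pred hI.
split=> [|c v w hv hw]; rewrite !mxE; first exact: (ideal0 hI').
by apply: (idealD hI') => //; apply: (idealM hI').
Qed.

Lemma fdim_ideal_part I u : idealr_closed I -> exists i, fdim (ideal_part I u) i.
Proof.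
move=> hI; apply: fdim_sub (fdim_homog_vec k (fun=> 0) u n0).
- exact: subspace_ideal_part.
- exact: subspace_homog_vec.
- by move=> v [].
Qed.

Lemma hilbert_fun_gquot I u i m : idealr_closed I ->
  fdim (ideal_part I u) i -> hilbert_fun (gquot I) u m -> (i + m = hdim n u)%N.
Proof.
move=> hI hi hm.
have hN : subspace (fun w : 'cV[R]_1 => w 0 0 \in I).
  have hI' := ideal_pred hI.
  split=> [|c v w hv hw]; rewrite !mxE; first exact: (ideal0 hI').
  by apply: (idealD hI') => //; apply: (idealM hI').
have := fdim_qdim (subspace_homog_vec k n (fun=> 0) u) hN hi hm.
move=> /(fdim_uniq (subspace_homog_vec k n _ u) (fdim_homog_vec k (fun=> 0) u n0)) <-.
by rewrite big_ord1 subr0.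
Qed.

Lemma fdim_inj (V W : lmodType R) (U : V -> Prop) (f : V -> W) m :
  subspace U ->
  (forall c v w, U v -> U w -> f (c%:MP *: v + w) = c%:MP *: f v + f w) ->
  (forall v, U v -> f v = 0 -> v = 0) -> fdim U m ->
  fdim (fun w => exists2 v, U v & f v = w) m.
Proof.
move=> hU fP finj /(fdimP _ hU) [b [Ub bfree bspan]].
have hI := subspace_morph hU fP.
have flin c := lincomb_morph hU fP c Ub.
apply/fdimP => //; exists (f \o b); split=> [i|c|_ [v /bspan [c ->] <-]].
- by exists (b i).
- by rewrite -flin => /(finj _ (subspace_lincomb c hU Ub)) /bfree.
- by exists c; rewrite flin.
Qed.

(* The Koszul complex of (a, b) in degree u. *)
Lemma regular_pair_count (a b : R) (da db : nat) (u : int) :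
  a \is da.-homog -> b \is db.-homog -> regular_pair a b ->
  exists2 j, fdim (fun w : 'cV[R]_1 => homog_vec (fun=> 0) u w /\
      exists x y, w 0 0 = a * x + b * y) j &
    (hdim n (u - da%:Z) + hdim n (u - db%:Z) = hdim n (u - da%:Z - db%:Z) + j)%N.
Proof.
move=> ha hb [a0 hab].
pose A : 'M[R]_(1, 2) := \row_(l < 2) if l == 0 then a else b.
pose sh (l : 'I_2) : int := if l == 0 then da%:Z else db%:Z.
have hA : graded_mx (fun=> 0) sh A.
  by move=> i l; rewrite !mxE /sh subr0; case: (l == 0).
have AE (v : 'cV[R]_2) : (A *m v) 0 0 = a * v 0 0 + b * v 1 0.
  by rewrite !mxE big_ord_recl big_ord1 !mxE /=; congr (_ + b * v _ _); apply/val_inj.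
have [j hj] := fdim_image (fun=> 0) A u n0; exists j.
  suff <- : (fun w => homog_vec (fun=> 0) u w /\ exists v, w = A *m v) =
     (fun w => homog_vec (fun=> 0) u w /\ exists x y, w 0 0 = a * x + b * y) by [].
  apply/funext => w; apply/propext; split=> [] [hw].
    by move=> [v Ev]; split=> //; exists (v 0 0), (v 1 0); rewrite Ev.
  move=> [x [y E]]; split=> //; exists (\col_l if l == 0 then x else y).
  by apply/matrixP => i l; rewrite !ord1 AE E !mxE.
suff hi : fdim (fun v => homog_vec sh u v /\ A *m v = 0) (hdim n (u - da%:Z - db%:Z)).
  by have := fdim_graded hA n0 hi hj; rewrite big_ord_recl big_ord1.
(* By regularity the syzygies of the row (a, b) are exactly the multiples of (b, -a). *)
pose g (z : R^o) : 'cV[R]_2 := \col_l if l == 0 then b * z else - (a * z).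
suff -> : (fun v => homog_vec sh u v /\ A *m v = 0) =
    (fun v => exists2 z : R^o, homogz (u - da%:Z - db%:Z) z & g z = v).
  apply: fdim_inj.
  - exact: subspace_homogz.
  - move=> c v w _ _; rewrite -[c%:MP *: v + w]/(c%:MP * (v : R) + (w : R) : R).
    by apply/matrixP => i l; rewrite !mxE; case: (i == 0); ring.
  - move=> v _ /matrixP /(_ 1 0); rewrite !mxE /= => /eqP.
    by rewrite oppr_eq0 mulf_eq0 (negbTE a0) => /eqP.
  - exact: fdim_homogz.
apply/funext => v; apply/propext; split=> [[hv /matrixP /(_ 0 0)]|[z hz <-]].
  rewrite AE mxE => E.
  have [z zE] := hab (v 1 0) (- v 0 0) ltac:(by apply/eqP; rewrite mulrN -addr_eq0 addrC E).
  exists (- z).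
    have h1 := hv 1; rewrite zE /sh /= in h1.
    rewrite addrAC; apply/homogzE; rewrite raddfN; congr (- _); apply/homogzE.
    exact: (@homogz_cancel _ _ _ da%:Z _ _ a0 ha h1).
  apply/matrixP => i l; rewrite ord1 !mxE; case: eqVneq => [->|i0].
    apply: (mulfI a0); apply/eqP; rewrite -subr_eq0; apply/eqP.
    by rewrite -oppr0 -E zE; ring.
  have -> : i = 1 by case: i i0 => [[|[]]] //= *; apply/val_inj.
  by rewrite zE; ring.
split.
  move=> i; rewrite !mxE /sh; case: (i == 0).
    by rewrite -[_ - da%:Z](addrNK db%:Z) addrC; apply: homogz_mul.
  apply/homogzE; rewrite raddfN; congr (- _); apply/homogzE.
  have -> : u - db%:Z = da%:Z + (u - da%:Z - db%:Z) by ring.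
  exact: homogz_mul.
by apply/matrixP => i l; rewrite !ord1 AE !mxE /=; ring.
Qed.

(* The Hilbert function of R/I is at most that of R/(a, b). *)
Lemma hilbert_fun_bound (I : {pred R}) (a b : R) (da db : nat) (u : int) m :
  idealr_closed I -> a \in I -> b \in I ->
  a \is da.-homog -> b \is db.-homog -> regular_pair a b ->
  hilbert_fun (gquot I) u m ->
  (m + hdim n (u - da%:Z) + hdim n (u - db%:Z) <=
   hdim n u + hdim n (u - da%:Z - db%:Z))%N.
Proof.
move=> hI aI bI ha hb hab hm.
have [i hi] := fdim_ideal_part u hI.
have [j hj E] := regular_pair_count u ha hb hab.
have Ei := hilbert_fun_gquot hI hi hm.
suff : (j <= i)%N by lia.
have hI' := ideal_pred hI.
apply: fdim_le hj hi; last 1 first.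
- move=> w [hw [x [y E']]]; split=> //; rewrite E' mulrC [b * y]mulrC.
  by apply: (idealD hI'); apply: (idealM hI').
- apply: subspaceI; first exact: subspace_homog_vec.
  split=> [|c v w [x [y E1]] [x' [y' E2]]]; first by exists 0, 0; rewrite mxE; ring.
  by exists (c%:MP * x + x'), (c%:MP * y + y'); rewrite !mxE E1 E2; ring.
- exact: subspace_ideal_part.
Qed.

Lemma bourbaki_count (p q : nat) (sh : 'I_p -> int) (A : 'M[R]_(p, q))
    (nu : 'cV[R]_q) (e s t : int) (I : {pred R}) i m :
  graded_mx sh (fun=> 0) A -> syz_deg A e nu -> nu != 0 -> bourbaki_ideal A nu s I ->
  fdim (ideal_part I (t + s)) i ->
  fdim (fun v => homog_vec (fun=> 0) t v /\ A *m v = 0) m ->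
  m = (hdim n (t - e) + i)%N.
Proof.
move=> hA [nuS nuh] nu0 [hI Ihom _ [phi [phiP Iphi phi0 phih]]] hi.
pose U (v : 'cV[R]_q) := homog_vec (fun=> 0) t v /\ A *m v = 0.
have hU : subspace U := subspace_ker (fun=> 0) A t.
move/(fdim_uniq hU); apply.
have [l nul] : exists l, nu l 0 != 0.
  apply: contrapT => h; move: nu0; apply/negP/negPn/eqP/matrixP => l j; rewrite ord1 mxE.
  by apply/eqP/contraT => hl; case: h; exists l.
pose f (v : 'cV[R]_q) : 'cV[R]_1 := const_mx (phi v).
apply: (@fdim_exact _ _ _ _ U f hU).
- move=> c v w [_ Sv] [_ Sw]; apply/matrixP => x y.
  by rewrite !mxE phiP.
- suff -> : (fun v => U v /\ f v = 0) =
      (fun v => exists2 x : R^o, homogz (t - e) x & x *: nu = v).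
    apply: fdim_inj.
    + exact: subspace_homogz.
    + by move=> c v w _ _; rewrite scalerDl scalerA.
    + move=> x _ /matrixP /(_ l 0) /eqP; rewrite !mxE mulf_eq0 (negbTE nul) orbF.
      by move=> /eqP.
    + exact: fdim_homogz.
  apply/funext => v; apply/propext; split=> [[[hv Sv]]|[x hx <-]].
    move=> /matrixP /(_ 0 0); rewrite !mxE => /(phi0 _ Sv) [x vx]; exists x => //.
    have := hv l; rewrite subr0 vx mxE mulrC; apply: homogz_cancel => //.
    by have := nuh l; rewrite subr0.
  have Sx : A *m (x *: nu) = 0 by rewrite -scalemxAr nuS scaler0.
  split; first split=> // j.
    rewrite subr0 mxE -(addrNK e t) ; apply: homogz_mul => //.
    by have := nuh j; rewrite subr0.
  apply/matrixP => j j'; rewrite !mxE; apply/(phi0 _ Sx); by exists x.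
- suff -> : (fun w => exists2 v, U v & f v = w) = ideal_part I (t + s) by [].
  apply/funext => w; apply/propext; split=> [[v [hv Sv] <-]|[hw /Iphi [v Sv vw]]].
    split; last by rewrite mxE; apply/Iphi; exists v.
    by move=> j; rewrite mxE subr0; apply: phih; split.
  have S0 : syz A 0 by rewrite /syz mulmx0.
  have phi_0 : phi 0 = 0 by apply/(phi0 _ S0); exists 0; rewrite scale0r.
  (* The preimage v given by [Iphi] need not be homogeneous. Its component of degree t is a preimage
     too, because phi sends components of distinct degrees to distinct degrees and [phi v] is
     homogeneous of degree t + s. *)
  pose c u := hcomp (fun=> 0) u v.
  have Sc u : syz A (c u).
    by rewrite /syz -(hcomp_mul hA) Sv; apply/matrixP => x y; rewrite !mxE raddf0.
  exists (c t); first by split; [apply: hcompP | apply: Sc].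
  (* Large enough for the sum to contain every component of v, including the index t when t is
     nonnegative. *)
  pose N := maxn `|t|.+1 (\max_j mmeasure mdeg (v j 0)%R).
  have vE : v = \sum_(i < N) c (val i)%:Z.
    apply/matrixP => j j'; rewrite ord1 summxE.
    under eq_bigr => i' _ do rewrite mxE subr0.
    apply: pihomog_partitionE; rewrite leq_max; apply/orP; right.
    by apply: (leq_bigmax_cond (F := fun j => mmeasure mdeg (v j 0))).
  have phi_sum (r : seq 'I_N) : syz A (\sum_(i' <- r) c (val i')%:Z) /\
      phi (\sum_(i' <- r) c (val i')%:Z) = \sum_(i' <- r) phi (c (val i')%:Z).
    elim: r => [|i' r [IHs IH]]; first by rewrite !big_nil.
    rewrite !big_cons -IH -[c _]scale1r; split.
      by rewrite /syz mulmxDr IHs addr0 scale1r; apply: Sc.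
    by rewrite phiP // scale1r mul1r.
  have phic u : homogz (u + s) (phi (c u)).
    by apply: phih; split; [apply: Sc | apply: hcompP].
  apply/matrixP => j j'; rewrite !ord1 mxE -vw.
  have /pihomogz_id <- : homogz (t + s) (phi v) by have := hw 0; rewrite subr0 vw.
  rewrite [in RHS]vE (phi_sum _).2 raddf_sum /=.
  have ne (u : int) : u != t -> pihomogz (t + s) (phi (c u)) = 0.
    move=> ut; apply: pihomogz_ne (phic u) _.
    by apply: contra_neq ut => /addIr.
  case: (ltP t 0) => t0.
    rewrite big1 => [|i' _]; last by apply: ne; lia.
    rewrite (_ : c t = 0) //; apply/matrixP => x y; rewrite !mxE subr0.
    by case: (t) t0.
  have tN : (`|t| < N)%N by rewrite leq_max leqnn.
  rewrite (bigD1 (Ordinal tN)) //= gez0_abs // pihomogz_id //.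
  rewrite big1 ?addr0 // => i' i't; apply: ne; apply: contra_neq i't => it.
  by apply/val_inj; rewrite /= -it.
Qed.

End HilbertCount.

(** * The Hilbert polynomial of R/I and the degree formula *)

Section Formula.
Variables (k : fieldType) (hk : infinite_field k) (N : nat).
Local Notation n := N.+3.
Local Notation R := {mpoly k[n]}.
Local Notation H := (binp N.+2).

Lemma hdim_shiftE (a : int) (t : nat) (u : int) : u = t%:Z + a -> 0 <= u ->
  (hdim n u)%:R = (shiftp a%:~R H).[t%:R] :> rat.
Proof. by move=> -> u0; rewrite -hdim_shift. Qed.

(** I contains a regular pair (a, b) of forms, so P lies between 0 and the Hilbert polynomial Q of
    R/(a, b) at large integers. Q is a second difference of a polynomial of degree N + 2, hence of
    degree at most N. *)
Lemma hilbert_poly_codim2 (I : {pred R}) (P : {poly rat}) :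
  idealr_closed I -> homog_ideal I -> krull_dim_le (gquot I) (n - 2) ->
  hilbert_poly (gquot I) P -> (size P <= N.+1)%N.
Proof.
move=> hI Ihom hkd [t0 hP].
have [a [b [da [db [aI bI ha hb hab]]]]] := @homog_regular_pair k n hk I isT hI Ihom hkd.
pose x : rat := - da%:R; pose y : rat := - db%:R.
pose Q := H + shiftp (x + y) H - shiftp x H - shiftp y H.
have [Hs _ _] := binp_coef N.
have Hs' z : (size (shiftp z H) <= n)%N.
  apply/leq_sizeP => j nj; rewrite coef_shiftp (_ : H^`N(j) = 0) ?horner0 //.
  apply/polyP => i; rewrite coef_nderivn coef0 nth_default ?mul0rn //.
  by rewrite (leq_trans Hs) // (leq_trans nj) // leq_addr.
have Qs : (size Q <= N.+1)%N.
  apply/leq_sizeP => j Nj; rewrite /Q !coefB !coefD.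
  have [jn|nj] := ltnP j n; last by rewrite !nth_default ?(leq_trans _ nj) //; ring.
  have [c2 c1 _] := coef_shiftp_top x Hs.
  have [d2 d1 _] := coef_shiftp_top y Hs.
  have [e2 e1 _] := coef_shiftp_top (x + y) Hs.
  have : j = N.+1 \/ j = N.+2 by lia.
  by case=> ->; rewrite ?c1 ?c2 ?d1 ?d2 ?e1 ?e2; ring.
apply/leq_sizeP => j Nj.
apply: (@eventually_bounded_coef P Q (t0 + da + db)) => [|t ht].
  exact: leq_trans Qs Nj.
have [|m hm ->] := hP t; first by lia.
rewrite ler0n /=.
have := hilbert_fun_bound (ltn0Sn _) hI aI bI ha hb hab hm.
rewrite -(ler_nat rat) !natrD.
rewrite (@hdim_shiftE 0 t t) ?addr0 //.
rewrite (@hdim_shiftE (- da%:Z) t) //; last by lia.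
rewrite (@hdim_shiftE (- db%:Z) t) //; last by lia.
rewrite (@hdim_shiftE (- da%:Z - db%:Z) t) //; [|ring|lia].
have -> : shiftp 0%:~R H = H.
  by rewrite /shiftp polyC0 addr0 comp_polyXr.
rewrite intrB !intrN -/x -/y -lerBrDr -lerBrDr /Q !hornerD !hornerN => h.
by apply: le_trans h _; lra.
Qed.

Lemma syz_indeg_uniq p q (A : 'M[R]_(p, q)) e e' :
  syz_indeg A e -> syz_indeg A e' -> e = e'.
Proof.
move=> [[v hv v0] h] [[w hw w0] h']; apply/eqP.
by rewrite eq_le (h _ _ hw w0) (h' _ _ hv v0).
Qed.

Lemma graded_Theta d1 d2 (Theta : 'M[R]_(2, 4)) :
  (forall i j, Theta i j \is (row_deg d1 d2 i).-homog) ->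
  graded_mx (target_shift d1 d2) (fun=> 0) Theta.
Proof. by move=> h i j; rewrite /target_shift opprK add0r; apply: h. Qed.

Lemma hilbert_fun_coker_syz d1 d2 (Theta : 'M[R]_(2, 4)) (t m i : nat) :
  (forall i j, Theta i j \is (row_deg d1 d2 i).-homog) ->
  hilbert_fun (gcoker (target_shift d1 d2) Theta) t m ->
  fdim (fun v : 'cV[R]_4 => homog_vec (fun=> 0) t v /\ Theta *m v = 0) i ->
  m%:R = (shiftp d1%:R H + shiftp d2%:R H).[t%:R] - 4 * H.[t%:R] + i%:R :> rat.
Proof.
move=> /graded_Theta hT hm hi.
have := hilbert_fun_gcoker hT (ltn0Sn _) hm hi.
move=> /(congr1 (fun x => x%:R : rat)); rewrite !natrD.
rewrite !big_ord_recl !big_ord0 !subr0 /target_shift /row_deg /= !opprK !natrD.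
rewrite (@hdim_shiftE 0 t t) ?addr0 //.
rewrite (@hdim_shiftE d1 t) // (@hdim_shiftE d2 t) //.
have -> : shiftp 0%:~R H = H by rewrite /shiftp polyC0 addr0 comp_polyXr.
by rewrite hornerD => E; lra.
Qed.

Theorem bourbaki_degree_formula (d1 d2 : nat) (Theta : 'M[R]_(2, 4))
    (hdeg : forall i j, Theta i j \is (row_deg d1 d2 i).-homog)
    (e : nat) (he : syz_indeg Theta e) (hfree : ~ syz_free Theta)
    (HP : {poly rat}) (e0 e1 : rat)
    (hHP : hilbert_poly (gcoker (target_shift d1 d2) Theta) HP)
    (hcoefs : hilbert_coefs n HP e0 e1) (b : rat) (hb : bourbaki_degree Theta b) :
  b = if e0 != 0
      then (e%:R - (d1 + d2)%:R) * (e%:R + e0) + (d1 ^ 2 + d2 ^ 2 + d1 * d2)%:R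
           + (e0 ^+ 2 + e0) / 2 + e1
      else e%:R * (e%:R - (d1 + d2)%:R) + (d1 ^ 2 + d2 ^ 2 + d1 * d2)%:R - e1.
Proof.
case: hb => [[/hfree//]|[_ [e' [nu [s [I [he' hnu nu0 hBI [D [P [hD hP bE]]]]]]]]]].
have Ee := syz_indeg_uniq he' he; rewrite {e' he'}Ee in hnu.
have [hI Ihom hkd _] := hBI.
(* R/I has Krull dimension n - 2 = N + 1, so its degree is read at t^N. *)
have DN : D = N by have := krull_dim_uniq hD hkd; rewrite subSS subSS subn0 => - [].
subst D; have Ps := hilbert_poly_codim2 hI Ihom hkd.2 hP.
have [[t0 hQ] [t1 hPt]] := (hHP, hP).
have hT := graded_Theta hdeg.
(* The last two terms count I(s) in degree t, that is I in degree t + s. *)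
have EHP : HP = shiftp d1%:R H + shiftp d2%:R H - 4 *: H
    + shiftp (- e%:R) H + shiftp s%:~R H - shiftp s%:~R P.
  apply: (@eventually_poly_eq _ _ (t0 + t1 + `|s|%N + e)) => t ht.
  have [|m hm ->] := hQ t; first by lia.
  have [i hi] := fdim_ker (fun=> 0) Theta t (ltn0Sn N.+2).
  have [j hj] := fdim_ideal_part (ltn0Sn N.+2) (t%:Z + s) hI.
  have [u Eu] : exists u, t%:Z + s = Posz u by exists `|(t%:Z + s)%R|%N; lia.
  have [|m' hm' Pu] := hPt u; first by lia.
  have hj' := hj; rewrite Eu in hj'.
  have E1 := hilbert_fun_gquot (ltn0Sn _) hI hj' hm'.
  have E2 := bourbaki_count (ltn0Sn _) hT hnu nu0 hBI hj hi.
  rewrite (hilbert_fun_coker_syz hdeg hm hi) E2 natrD.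
  rewrite (@hdim_shiftE (- e%:Z) t) //; last by lia.
  have -> : j%:R = (hdim n u)%:R - m'%:R :> rat by rewrite -E1 natrD addrK.
  rewrite (@hdim_shiftE s t) // -Pu intrN.
  have -> : P.[u%:R] = (shiftp s%:~R P).[t%:R].
    by rewrite shiftp_eval; congr (_.[_]); rewrite -[u%:R]/((u%:Z)%:~R) -Eu intrD.
  by rewrite !hornerD !hornerN !hornerZ; ring.
have [Hs H2 H1] := binp_coef N.
have [_ _ hd2] := coef_shiftp_top d1%:R Hs; have [_ hd1 _] := coef_shiftp_top d1%:R Hs.
have [_ _ gd2] := coef_shiftp_top d2%:R Hs; have [_ gd1 _] := coef_shiftp_top d2%:R Hs.
have [_ _ ed2] := coef_shiftp_top (- e%:R) Hs; have [_ ed1 _] := coef_shiftp_top (- e%:R) Hs.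
have [_ _ sd2] := coef_shiftp_top s%:~R Hs; have [_ sd1 _] := coef_shiftp_top s%:~R Hs.
have Ps3 : (size P <= N.+3)%N by apply: leq_trans Ps _; lia.
have [_ pd1 pd2] := coef_shiftp_top s%:~R Ps3.
have P2 : P`_N.+2 = 0 by apply: nth_default; apply: leq_trans Ps _.
have P1 : P`_N.+1 = 0 by apply: nth_default.
have fN : N`!%:R != 0 :> rat by rewrite pnatr_eq0 -lt0n fact_gt0.
have n1 : N.+1%:R != 0 :> rat by rewrite pnatr_eq0.
have n2 : N.+2%:R != 0 :> rat by rewrite pnatr_eq0.
have PN : P`_N = b / N`!%:R by rewrite bE mulrC mulKf.
have f1 : N.+1`!%:R = N.+1%:R * N`!%:R :> rat by rewrite factS natrM.
have f2 : N.+2`!%:R = N.+2%:R * N.+1%:R * N`!%:R :> rat by rewrite factS natrM f1 mulrA.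
have [] := hcoefs; rewrite !subSS !subn0 EHP !coefD !coefN !(coefZ 4).
rewrite hd1 gd1 ed1 sd1 pd1 hd2 gd2 ed2 sd2 pd2 P1 P2 H1 H2 !f2 f1 PN.
have -> : N.+3%:R = N.+2%:R + 1 :> rat by rewrite natr1.
have -> : N.+2%:R = N.+1%:R + 1 :> rat by rewrite natr1.
rewrite !natrD !natrX natrM.
have x1 : N.+1%:R + 1 != 0 :> rat by rewrite natr1.
(* Only field algebra remains: x = n - 2, F = (n - 3)!, a and a' are the row degrees, y = e and z =
   s. *)
move: (N.+1%:R : rat) (N`!%:R : rat) (d1%:R : rat) (d2%:R : rat) (e%:R : rat)
  (s%:~R : rat) (H`_N) n1 x1 fN => x F a a' y z h0 x0 x1 F0 E1 E2.
have e0E : e0 = a + a' - y + z.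
  have -> : e0 = e0 / (x * F) * (x * F) by field; rewrite x0 F0.
  by rewrite -E1; field; rewrite x0 F0 x1.
have {}E2 : b = (x + 1 + 1) * e0 / 2 + (a ^+ 2 + a' ^+ 2 + y ^+ 2 + z ^+ 2) / 2
    - F * (if e0 == 0 then e1 / F else ((x + 1) * e0 - 2 * e1) / (2 * F)).
  by rewrite -E2 e0E; field; rewrite x0 F0 x1.
have zE : z = e0 - a - a' + y by rewrite e0E; ring.
(* The case split reflects the sign convention for e_1 in [hilbert_coefs]. *)
rewrite E2 zE; case: eqVneq => [->|e00] /=; field => //.
Qed.


End Formula.

(** * Exactness of Buchsbaum-Rim complexes *)

Section Acyclicity.
Variable (A : idomainType).
Variables (p q r s : nat) (d1 : 'M[A]_(p, q)) (d2 : 'M[A]_(q, r)) (d3 : 'M[A]_(r, s)).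
Hypotheses (d23 : d2 *m d3 = 0) (d3inj : forall c : 'cV_s, d3 *m c = 0 -> c = 0).

Definition annihilates_homology (x : A) : Prop :=
  (forall z : 'cV_q, d1 *m z = 0 -> exists u, x *: z = d2 *m u) /\
  (forall u : 'cV_r, d2 *m u = 0 -> exists c, x *: u = d3 *m c).

(** Reduces the claim for the whole ideal of minors to single minors. *)
Lemma annihilates_homology_ideal : ideal annihilates_homology.
Proof.
split.
- split=> [z _|u _]; exists 0; by rewrite scale0r mulmx0.
- move=> x y [hx1 hx2] [hy1 hy2]; split=> [z hz|u hu].
    have [u E] := hx1 z hz; have [u' E'] := hy1 z hz.
    by exists (u + u'); rewrite scalerDl E E' mulmxDr.
  have [c E] := hx2 u hu; have [c' E'] := hy2 u hu.
  by exists (c + c'); rewrite scalerDl E E' mulmxDr.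
- move=> a x [hx1 hx2]; split=> [z /hx1 [u E]|u /hx2 [c E]].
    by exists (a *: u); rewrite -scalerA E scalemxAr.
  by exists (a *: c); rewrite -scalerA E scalemxAr.
Qed.

(** An acyclicity lemma as an explicit chase: division by a, using b, gives exactness at the second
    spot; a third element is needed one step further, to correct the chosen lifts by boundaries. *)
Lemma regular_exact (a b c : A) :
  regular_seq (fun x => x = 0) [:: a; b; c] ->
  annihilates_homology a -> annihilates_homology b -> annihilates_homology c ->
  (forall z : 'cV_q, d1 *m z = 0 -> exists u, z = d2 *m u) /\
  (forall u : 'cV_r, d2 *m u = 0 -> exists w, u = d3 *m w).
Proof.
move=> [ha [hb [hc _]]] [ka1 ka2] [kb1 kb2] [kc1 _].
have a0 : a != 0.
  by apply/eqP => a0; move: (ha 1); rewrite a0 mul0r => /(_ erefl) /eqP; rewrite oner_eq0.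
have ainj m (v w : 'cV[A]_m) : a *: v = a *: w -> v = w.
  move=> /matrixP E; apply/matrixP => i j; apply: (mulfI a0).
  by have := E i j; rewrite !mxE.
have hab m (v w : 'cV[A]_m) : b *: v = a *: w -> exists x, v = a *: x.
  move=> /matrixP E; have /choice [f hf] : forall i, exists z, v i 0 = a * z.
    move=> i; have [|z [y [-> ->]]] := hb (v i 0); last by exists y; rewrite add0r mulrC.
    exists 0, (w i 0); rewrite add0r [w i 0 * a]mulrC.
    by have := E i 0; rewrite !mxE.
  by exists (\col_i f i); apply/matrixP => i j; rewrite ord1 !mxE.
have habc m (v w w' : 'cV[A]_m) : c *: v = a *: w + b *: w' ->
    exists x y, v = a *: x + b *: y.
  move=> /matrixP E.
  have /choice [f hf] : forall i, exists z : A * A, v i 0 = a * z.1 + b * z.2.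
    move=> i; have [|_ [y [[z [x [-> ->]]] ->]]] := hc (v i 0); last first.
      by exists (x, y) => /=; ring.
    exists (0 + w i 0 * a), (w' i 0); split; first by exists 0, (w i 0).
    by have := E i 0; rewrite !mxE => ->; ring.
  exists (\col_i (f i).1), (\col_i (f i).2).
  by apply/matrixP => i j; rewrite ord1 !mxE.
have ex2 (u : 'cV_r) : d2 *m u = 0 -> exists w, u = d3 *m w.
  move=> du; have [c1 E1] := ka2 u du; have [c2 E2] := kb2 u du.
  have E : b *: c1 = a *: c2.
    apply/eqP; rewrite -subr_eq0; apply/eqP/d3inj.
    by rewrite mulmxBr -!scalemxAr -E1 -E2 !scalerA mulrC subrr.
  have [x c1E] := hab _ _ _ E; exists x.
  by apply: ainj; rewrite E1 c1E scalemxAr.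
split=> // z dz.
have [u1 E1] := ka1 z dz; have [u2 E2] := kb1 z dz; have [u3 E3] := kc1 z dz.
have ker x y (u v : 'cV_r) : x *: z = d2 *m u -> y *: z = d2 *m v ->
    exists w, y *: u - x *: v = d3 *m w.
  move=> Eu Ev; apply: ex2.
  by rewrite mulmxBr -!scalemxAr -Eu -Ev !scalerA mulrC subrr.
(* The cycles b u1 - a u2, c u1 - a u3, c u2 - b u3 come from w1, w2, w3, and
   c w1 - b w2 + a w3 = 0 puts w1 in (a, b). *)
have [w1 W1] := ker _ _ _ _ E1 E2; have [w2 W2] := ker _ _ _ _ E1 E3.
have [w3 W3] := ker _ _ _ _ E2 E3.
have E : c *: w1 = a *: (- w3) + b *: w2.
  apply/eqP; rewrite -subr_eq0; apply/eqP/d3inj.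
  rewrite mulmxBr mulmxDr -!scalemxAr mulmxN -W1 -W2 -W3.
  by apply/matrixP => i j; rewrite !mxE; ring.
have [x [y w1E]] := habc _ _ _ _ E.
(* Adding boundaries turns b u1 - a u2 into 0, so the corrected u1 is divisible by a; the correction
   is invisible to d2. *)
have [|v Ev] := hab _ (u1 - d3 *m y) (u2 + d3 *m x).
  apply/eqP; rewrite -subr_eq0; apply/eqP.
  have -> : b *: (u1 - d3 *m y) - a *: (u2 + d3 *m x)
      = (b *: u1 - a *: u2) - (a *: (d3 *m x) + b *: (d3 *m y)).
    by apply/matrixP => i j; rewrite !mxE; ring.
  by rewrite W1 w1E mulmxDr -!scalemxAr subrr.
exists v; apply: ainj; rewrite E1 scalemxAr -Ev mulmxBr mulmxA d23 mul0mx subr0 //.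
Qed.

End Acyclicity.

(** * Degrees in the Buchsbaum-Rim complex *)

Section BuchsbaumRimGraded.
Variables (k : fieldType) (n : nat).
Local Notation R := {mpoly k[n]}.

Lemma homogz_prod (I : finType) (d : I -> int) (F : I -> R) :
  (forall i, homogz (d i) (F i)) -> homogz (\sum_i d i) (\prod_i F i).
Proof.
move=> hF; elim/big_rec2: _ => [|i x y _ hy]; first exact: dhomog1.
exact: homogz_mul.
Qed.

Lemma homogzN t (p : R) : homogz t p -> homogz t (- p).
Proof. by move=> /homogzE E; apply/homogzE; rewrite raddfN /= E. Qed.

Lemma homogz_sign t (p : R) (i : nat) : homogz t p -> homogz t ((-1) ^+ i * p).
Proof. by move=> hp; rewrite -signr_odd mulr_sign; case: odd => //; apply: homogzN. Qed.

Lemma homogz_sum t (T : Type) (r : seq T) (P : pred T) (F : T -> R) :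
  (forall i, P i -> homogz t (F i)) -> homogz t (\sum_(i <- r | P i) F i).
Proof.
move=> hF; apply/homogzE; rewrite raddf_sum; apply: eq_bigr => i Pi /=.
by apply: pihomogz_id; apply: hF.
Qed.

Lemma homogz_det m (a b : 'I_m -> int) (M : 'M[R]_m) : graded_mx a b M ->
  homogz (\sum_i b i - \sum_i a i) (\det M).
Proof.
move=> hM; rewrite /determinant; apply: homogz_sum => s _.
apply: homogz_sign; have -> : \sum_i b i = \sum_i b (s i).
  by rewrite [LHS](reindex_inj (@perm_inj _ s)).
by rewrite -sumrB; apply: homogz_prod => i; apply: hM.
Qed.

Lemma br_psi_graded m (a : 'I_m -> int) (b : 'I_m.+2 -> int) (A : 'M[R]_(m, m.+2)) :
  graded_mx a b A ->
  graded_mx b (fun j => \sum_j b j - \sum_i a i - b j) (br_psi A).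
Proof.
move=> hA i j; rewrite mxE; case: unliftP => [l ->|_]; last first.
  by apply: (subspace_homogz _ _ _).1.
apply: homogz_sign; rewrite (bigD1_ord i) //= (bigD1_ord l) //=.
set S := \sum_(i < m) b _.
have -> : b i + (b (lift i l) + S) - \sum_i a i - b (lift i l) - b i = S - \sum_i a i by ring.
by apply: homogz_det => x y; rewrite !mxE; apply: hA.
Qed.

Lemma buchsbaum_rim_graded m (a : 'I_m -> int) (b : 'I_m.+2 -> int)
    (A : 'M[R]_(m, m.+2)) (C := buchsbaum_rim a b A) : graded_mx a b A ->
  [/\ graded_mx (cs0 C) (cs1 C) (cd1 C), graded_mx (cs1 C) (cs2 C) (cd2 C)
    & graded_mx (cs2 C) (cs3 C) (cd3 C)].
Proof.
move=> hA; split=> //; first exact: br_psi_graded.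
move=> i j; rewrite mxE /=.
by have := hA j i; congr homogz; ring.
Qed.

Lemma homogz_gt0_coef0 t (p : R) : 0 < t -> homogz t p -> p@_0%MM = 0.
Proof.
case: t => // d d0 /= hp; apply: (dhomog_nemf_coeff hp); rewrite /= mdeg0.
by rewrite eq_sym -lt0n.
Qed.

End BuchsbaumRimGraded.

(** * Minors annihilate the homology *)

Section Koszul.
Variables (k : fieldType) (n : nat).
Local Notation R := {mpoly k[n]}.

Lemma br_psi_lift m (A : 'M[R]_(m, m.+2)) i l :
  br_psi A i (lift i l) = (-1) ^+ (i + l) * \det (col' l (col' i A)).
Proof. by rewrite mxE liftK. Qed.

Lemma br_psi_diag m (A : 'M[R]_(m, m.+2)) i : br_psi A i i = 0.
Proof. by rewrite mxE unlift_none. Qed.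

Lemma det_mx22 (M : 'M[R]_2) : \det M = M 0 0 * M 1 1 - M 0 1 * M 1 0.
Proof.
rewrite (expand_det_row _ 0) !big_ord_recl big_ord0 /cofactor !det_mx11 !mxE /=.
rewrite expr0 expr1 !mul1r addr0 mulN1r mulrN.
by congr (_ * M _ _ - M _ _ * M _ _); apply/val_inj.
Qed.

Lemma inordP m (p : nat) (A : 'M[R]_(p, m.+1)) i j : A i j = A i (inord (val j)).
Proof. by rewrite inord_val. Qed.

Section M1.
Variable (A : 'M[R]_(1, 3)).
(** Indexing by naturals makes the entries syntactically equal atoms for [ring] once ordinals are
    split into cases. *)
Let F (j : nat) : R := A 0 (inord j).

Lemma br_psi1E (i j : 'I_3) : br_psi A i j =
  nth 0 (nth [::] [:: [:: 0; F 2; - F 1]; [:: - F 2; 0; F 0]; [:: F 1; - F 0; 0]] i) j.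
Proof.
case: (unliftP i j) => [l ->|->]; last first.
  by rewrite br_psi_diag; case: i => [[|[|[|]]]].
rewrite br_psi_lift det_mx11 !mxE inordP; case: i => [[|[|[|//]]] hi];
  case: l => [[|[|//]] hl]; rewrite /F /=; ring.
Qed.

Let AE (i : 'I_1) (j : 'I_3) : A i j = F (val j).
Proof. by rewrite ord1 /F inord_val. Qed.

Let colE (z : 'cV[R]_3) i : z i 0 = z (inord (val i)) 0.
Proof. by rewrite inord_val. Qed.

Lemma br1_complex1 : A *m br_psi A = 0.
Proof.
apply/matrixP => i j; rewrite !mxE; under eq_bigr => l _ do rewrite br_psi1E AE.
rewrite !big_ord_recl big_ord0 /bump /=.
by case: j => [[|[|[|//]]] hj] /=; ring.
Qed.

Lemma br1_complex2 : br_psi A *m A^T = 0.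
Proof.
apply/matrixP => i j; rewrite !mxE; under eq_bigr => l _ do rewrite br_psi1E mxE AE.
rewrite !big_ord_recl big_ord0 /bump /=.
by case: i => [[|[|[|//]]] hj] /=; ring.
Qed.

Let mul_psi (us : seq R) (i : 'I_3) :
  (br_psi A *m \col_(l < 3) nth 0 us l) i 0 =
  nth 0 [:: F 2 * us`_1 - F 1 * us`_2; - F 2 * us`_0 + F 0 * us`_2;
            F 1 * us`_0 - F 0 * us`_1] i.
Proof.
rewrite !mxE; under eq_bigr => l _ do rewrite br_psi1E mxE.
rewrite !big_ord_recl big_ord0 /bump /=.
by case: i => [[|[|[|//]]] hj] /=; ring.
Qed.

(** The Koszul homotopy: wedging a cycle with the j-th basis vector bounds F j times it. One step
    up, psi u = 0 says that the 2-minors of the rows F and u vanish, so F j * u is u_j times A^T. *)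
Lemma br1_annihilates (j : 'I_3) :
  annihilates_homology A (br_psi A) A^T (A 0 j).
Proof.
split.
  move=> z /matrixP /(_ 0 0); rewrite !mxE.
  under eq_bigr => l _ do rewrite AE colE.
  rewrite !big_ord_recl big_ord0 /bump /=.
  set Z0 := z _ 0; set Z1 := z _ 0; set Z2 := z _ 0.
  rewrite addr0 => hz.
  have h0 : F 0 * Z0 = - (F 1 * Z1 + F 2 * Z2) by apply/eqP; rewrite -addr_eq0 hz.
  have h1 : F 1 * Z1 = - (F 0 * Z0 + F 2 * Z2) by rewrite h0; ring.
  have h2 : F 2 * Z2 = - (F 0 * Z0 + F 1 * Z1) by rewrite h0; ring.
  rewrite AE.
  exists (\col_(l < 3) nth 0 (nth [::]
    [:: [:: 0; - Z2; Z1]; [:: Z2; 0; - Z0]; [:: - Z1; Z0; 0]] j) l).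
  apply/matrixP => i i'; rewrite ord1 mul_psi mxE (colE z i).
  case: j => [[|[|[|//]]] hj]; case: i => [[|[|[|//]]] hi] /=; rewrite -?/Z0 -?/Z1 -?/Z2;
    first [ring | ring: h0 | ring: h1 | ring: h2].
move=> u du; pose U l := u (inord l) 0.
have uE : u = \col_(l < 3) nth 0 [:: U 0; U 1; U 2] l.
  by apply/matrixP => x y; rewrite ord1 mxE colE; case: x => [[|[|[|//]]] hx].
move: du; rewrite {1}uE => /matrixP du.
have P (x : 'I_3) := du x 0.
have P0 := P ord0; have P1 := P (Ordinal (isT : 1 < 3)%N).
have P2 := P (Ordinal (isT : 2 < 3)%N).
rewrite !mul_psi !mxE /= in P0 P1 P2.
have h0 : F 2 * U 1 = F 1 * U 2 by apply/eqP; rewrite -subr_eq0 -P0; apply/eqP; ring.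
have h1 : F 0 * U 2 = F 2 * U 0 by apply/eqP; rewrite -subr_eq0 -P1; apply/eqP; ring.
have h2 : F 1 * U 0 = F 0 * U 1 by apply/eqP; rewrite -subr_eq0 -P2; apply/eqP; ring.
exists (\col_l u j 0); apply/matrixP => i i'; rewrite ord1 !mxE big_ord1 !mxE AE AE.
rewrite (colE u i) (colE u j).
by case: j => [[|[|[|//]]] hj]; case: i => [[|[|[|//]]] hi] /=; rewrite -?/(U _);
   first [ring | ring: h0 | ring: h1 | ring: h2].
Qed.

End M1.

Section M2.
Variable (A : 'M[R]_(2, 4)).
Let F (j : nat) : R := A 0 (inord j).
Let G (j : nat) : R := A 1 (inord j).
Let D i j := F i * G j - F j * G i.

Lemma br_psi2E (i j : 'I_4) : br_psi A i j =
  nth 0 (nth [::] [:: [:: 0; D 2 3; - D 1 3; D 1 2];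
                      [:: - D 2 3; 0; D 0 3; - D 0 2];
                      [:: D 1 3; - D 0 3; 0; D 0 1];
                      [:: - D 1 2; D 0 2; - D 0 1; 0]] i) j.
Proof.
case: (unliftP i j) => [l ->|->]; last first.
  by rewrite br_psi_diag; case: i => [[|[|[|[|]]]]].
rewrite br_psi_lift det_mx22 !mxE !(inordP A _ (lift i (lift l 0))).
rewrite !(inordP A _ (lift i (lift l 1))).
case: i => [[|[|[|[|//]]]] hi]; case: l => [[|[|[|//]]] hl];
  rewrite /D /F /G /bump /=; ring.
Qed.

Let A0E (j : 'I_4) : A 0 j = F (val j). Proof. by rewrite /F inord_val. Qed.
Let A1E (j : 'I_4) : A 1 j = G (val j). Proof. by rewrite /G inord_val. Qed.

Let colE (z : 'cV[R]_4) i : z i 0 = z (inord (val i)) 0.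
Proof. by rewrite inord_val. Qed.

Lemma br2_complex1 : A *m br_psi A = 0.
Proof.
apply/matrixP => i j; rewrite !mxE.
have [->|->] : i = 0 \/ i = 1 by case: i => [[|[|//]] hi]; [left|right]; apply/val_inj.
  under eq_bigr => l _ do rewrite br_psi2E A0E.
  rewrite !big_ord_recl big_ord0 /bump /=.
  by case: j => [[|[|[|[|//]]]] hj] /=; rewrite /D; ring.
under eq_bigr => l _ do rewrite br_psi2E A1E.
rewrite !big_ord_recl big_ord0 /bump /=.
by case: j => [[|[|[|[|//]]]] hj] /=; rewrite /D; ring.
Qed.

Lemma br2_complex2 : br_psi A *m A^T = 0.
Proof.
apply/matrixP => i j; rewrite !mxE.
have [->|->] : j = 0 \/ j = 1 by case: j => [[|[|//]] hj]; [left|right]; apply/val_inj.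
  under eq_bigr => l _ do rewrite br_psi2E mxE A0E.
  rewrite !big_ord_recl big_ord0 /bump /=.
  by case: i => [[|[|[|[|//]]]] hj] /=; rewrite /D; ring.
under eq_bigr => l _ do rewrite br_psi2E mxE A1E.
rewrite !big_ord_recl big_ord0 /bump /=.
by case: i => [[|[|[|[|//]]]] hj] /=; rewrite /D; ring.
Qed.

Let mul_psi (us : seq R) (i : 'I_4) :
  (br_psi A *m \col_(l < 4) nth 0 us l) i 0 =
  nth 0 [:: D 2 3 * us`_1 - D 1 3 * us`_2 + D 1 2 * us`_3;
            - D 2 3 * us`_0 + D 0 3 * us`_2 - D 0 2 * us`_3;
            D 1 3 * us`_0 - D 0 3 * us`_1 + D 0 1 * us`_3;
            - D 1 2 * us`_0 + D 0 2 * us`_1 - D 0 1 * us`_2] i.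
Proof.
rewrite !mxE; under eq_bigr => l _ do rewrite br_psi2E mxE.
rewrite !big_ord_recl big_ord0 /bump /=.
by case: i => [[|[|[|[|//]]]] hj] /=; ring.
Qed.

Let kernel1 (i j : nat) : (i < 4)%N -> (j < 4)%N -> (i < j)%N ->
  forall z : 'cV[R]_4, A *m z = 0 -> exists u, D i j *: z = br_psi A *m u.
Proof.
move=> hi hj ij z /matrixP hz.
have hF : \sum_(l < 4) F (val l) * z (inord (val l)) 0 = 0.
  by move: (hz 0 0); rewrite !mxE; under eq_bigr => l _ do rewrite A0E colE.
have hG : \sum_(l < 4) G (val l) * z (inord (val l)) 0 = 0.
  by move: (hz 1 0); rewrite !mxE; under eq_bigr => l _ do rewrite A1E colE.
move: hG hF; rewrite !big_ord_recl !big_ord0 /bump /=.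
set Z0 := z (inord 0) 0; set Z1 := z (inord 1) 0; set Z2 := z (inord 2) 0.
set Z3 := z (inord 3) 0; rewrite !addr0 => hG hF.
(* As in Cramer's rule, each coordinate is an identity up to a combination of the two rows of A z =
   0 with coefficients G m and F m of opposite signs, which eliminates column m. *)
have lin p q x y : x + p * (F 0 * Z0 + (F 1 * Z1 + (F 2 * Z2 + F 3 * Z3)))
    + q * (G 0 * Z0 + (G 1 * Z1 + (G 2 * Z2 + G 3 * Z3))) = y -> x = y :> R.
  by rewrite hF hG !mulr0 !addr0.
(* Supported on the two columns other than i and j. *)
pose us := if (i, j) == (0, 1)%N then [:: 0; 0; - Z3; Z2] else
  if (i, j) == (0, 2)%N then [:: 0; Z3; 0; - Z1] else
  if (i, j) == (0, 3)%N then [:: 0; - Z2; Z1; 0] else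
  if (i, j) == (1, 2)%N then [:: - Z3; 0; 0; Z0] else
  if (i, j) == (1, 3)%N then [:: Z2; 0; - Z0; 0] else [:: - Z1; Z0; 0; 0].
exists (\col_(l < 4) nth 0 us l); apply/matrixP => x y; rewrite ord1 mul_psi mxE colE /us.
move: i j hi hj ij {us}; case=> [|[|[|[|//]]]]; case=> [|[|[|[|//]]]] //= _ _ _;
  case: x => [[|[|[|[|//]]]] hx] /=; rewrite -?/Z0 -?/Z1 -?/Z2 -?/Z3 /D;
  first [ring
   | apply: (lin (- G 0) (F 0)); ring | apply: (lin (G 0) (- F 0)); ring
   | apply: (lin (- G 1) (F 1)); ring | apply: (lin (G 1) (- F 1)); ring
   | apply: (lin (- G 2) (F 2)); ring | apply: (lin (G 2) (- F 2)); ring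
   | apply: (lin (- G 3) (F 3)); ring | apply: (lin (G 3) (- F 3)); ring].
Qed.

Let kernel2 (i j : nat) : (i < 4)%N -> (j < 4)%N -> (i < j)%N ->
  forall u : 'cV[R]_4, br_psi A *m u = 0 -> exists c, D i j *: u = A^T *m c.
Proof.
move=> hi hj ij u du.
pose U l := u (inord l) 0.
have uE : u = \col_(l < 4) nth 0 [:: U 0; U 1; U 2; U 3] l.
  by apply/matrixP => x y; rewrite ord1 mxE colE; case: x => [[|[|[|[|//]]]] hx].
move: du; rewrite {1}uE => /matrixP du.
have P (x : 'I_4) := du x 0.
have P0 := P ord0; have P1 := P (Ordinal (isT : 1 < 4)%N).
have P2 := P (Ordinal (isT : 2 < 4)%N); have P3 := P (Ordinal (isT : 3 < 4)%N).
rewrite !mul_psi !mxE /= in P0 P1 P2 P3.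
(* Cramer's rule for A^T c = D i j u restricted to the rows i and j. *)
exists (\col_(r < 2) nth 0 [:: G j * U i - G i * U j; F i * U j - F j * U i] r).
apply/matrixP => x y; rewrite ord1 mxE colE mxE !big_ord_recl big_ord0 !mxE /=.
have -> : lift ord0 ord0 = 1 :> 'I_2 by apply/val_inj.
rewrite A0E A1E -/(U _).
(* On the other two rows this is a Pluecker relation, i.e. a row of psi u = 0. *)
have addz p q r : r = 0 -> p + r = q -> p = q :> R by move=> ->; rewrite addr0.
have subz p q r : r = 0 -> p - r = q -> p = q :> R by move=> ->; rewrite subr0.
move: i j hi hj ij; case=> [|[|[|[|//]]]]; case=> [|[|[|[|//]]]] //= _ _ _;
  case: x => [[|[|[|[|//]]]] hx] /=; rewrite /D;
  first [ring | apply: (addz _ _ _ P0); rewrite /D; ring | apply: (subz _ _ _ P0); rewrite /D; ring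
   | apply: (addz _ _ _ P1); rewrite /D; ring | apply: (subz _ _ _ P1); rewrite /D; ring
   | apply: (addz _ _ _ P2); rewrite /D; ring | apply: (subz _ _ _ P2); rewrite /D; ring
   | apply: (addz _ _ _ P3); rewrite /D; ring | apply: (subz _ _ _ P3); rewrite /D; ring].
Qed.

Lemma br2_annihilates (i j : 'I_4) :
  annihilates_homology A (br_psi A) A^T (A 0 i * A 1 j - A 0 j * A 1 i).
Proof.
have hI := annihilates_homology_ideal A (br_psi A) A^T.
wlog ij : i j / (val i < val j)%N.
  move=> h; have [ij|ji|/val_inj ->] := ltngtP (val i) (val j); first exact: h.
    rewrite -opprB; apply: (idealN hI); exact: h.
  by rewrite subrr; apply: (ideal0 hI).
rewrite !A0E !A1E -/(D i j); split; first exact: kernel1.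
exact: kernel2.
Qed.

End M2.
End Koszul.

(** * The case of codimension three *)

Section MinorIdeal.
Variables (k : fieldType) (n : nat).
Local Notation R := {mpoly k[n]}.
Variable A : 'M[R]_(2, 4).

Definition minor2 (i j : 'I_4) : R := A 0 i * A 1 j - A 0 j * A 1 i.

Definition minor_ideal (x : R) : Prop :=
  exists C : 'M[R]_4, x = \sum_i \sum_j C i j * minor2 i j.

Lemma minor_ideal_ideal : ideal minor_ideal.
Proof.
split.
- exists 0; rewrite big1 // => i _; rewrite big1 // => j _; by rewrite mxE mul0r.
- move=> _ _ [C ->] [C' ->]; exists (C + C'); rewrite -big_split; apply: eq_bigr => i _.
  by rewrite -big_split; apply: eq_bigr => j _; rewrite mxE mulrDl.
- move=> a _ [C ->]; exists (a *: C); rewrite mulr_sumr; apply: eq_bigr => i _.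
  by rewrite mulr_sumr; apply: eq_bigr => j _; rewrite mxE mulrA.
Qed.

Lemma minor_ideal_sub (I : R -> Prop) : ideal I ->
  (forall i j, I (minor2 i j)) -> forall x, minor_ideal x -> I x.
Proof.
move=> hI hm _ [C ->]; apply: ideal_sum => // i _; apply: ideal_sum => // j _.
exact: idealM.
Qed.

(* x . 1 = A B gives x^2 = det (A B), expanded by Cauchy-Binet. *)
Lemma gann_minor_ideal (a : 'I_2 -> int) x :
  gann (gcoker a A) x -> minor_ideal (x ^+ 2).
Proof.
move=> hx; have [w0 /matrixP E0] := hx (delta_mx 0 0).
have [w1 /matrixP E1] := hx (delta_mx 1 0).
have := E0 0 0; have := E0 1 0; have := E1 0 0; have := E1 1 0.
rewrite /= !mxE !mulr1 !mulr0 => g1 f1 g0 f0.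
exists (\matrix_(i, j) (w0 i 0 * w1 j 0)).
have -> : x ^+ 2 = (\sum_j A 0 j * w0 j 0) * (\sum_j A 1 j * w1 j 0)
    - (\sum_j A 0 j * w1 j 0) * (\sum_j A 1 j * w0 j 0).
  by rewrite -f0 -f1 -g0 -g1 mul0r subr0.
rewrite [X in _ - X]mulrC !mulr_suml -sumrB; apply: eq_bigr => i _.
rewrite !mulr_sumr -sumrB; apply: eq_bigr => j _.
by rewrite mxE /minor2; ring.
Qed.

Lemma minor_ideal_homog d1 d2 d f :
  (forall i j, A i j \is (row_deg d1 d2 i).-homog) ->
  minor_ideal f -> minor_ideal (pihomog mdeg d f).
Proof.
move=> hA [C ->]; exists (\matrix_(i, j) pihomogz (d%:Z - (d1 + d2)%N%:Z) (C i j)).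
rewrite -[pihomog mdeg d]/(pihomogz d%:Z) raddf_sum; apply: eq_bigr => i _.
rewrite raddf_sum; apply: eq_bigr => j _ /=.
have hm : homogz (d1 + d2)%N%:Z (minor2 i j).
  have h0 l : A 0 l \is d1.-homog := hA 0 l.
  have h1 l : A 1 l \is d2.-homog := hA 1 l.
  by apply: rpredB; apply: dhomogM.
by rewrite [C i j * _]mulrC (pihomogz_mul _ _ hm) mxE mulrC.
Qed.

Hypothesis hrank : mx_rank_frac A = 2%N.

Lemma rank2_tr_inj (c : 'cV[R]_2) : A^T *m c = 0 -> c = 0.
Proof.
move=> /(congr1 trmx); rewrite trmx_mul trmxK trmx0.
move=> /(congr1 (map_mx (@tofrac R))); rewrite map_mxM map_mx0 => E.
have /row_free_inj inj : row_free (map_mx (@tofrac R) A).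
  by rewrite /row_free; move: hrank; rewrite /mx_rank_frac => ->.
have c0 : map_mx (@tofrac R) c^T = 0 by apply: inj; rewrite E mul0mx.
apply/matrixP => i j; have /matrixP /(_ j i) := c0; rewrite !mxE => /eqP.
by rewrite tofrac_eq0 => /eqP.
Qed.

Lemma rank2_row_neq0 i : exists j, A i j != 0.
Proof.
apply: contrapT => h.
have /rank2_tr_inj /matrixP /(_ i 0) : A^T *m (delta_mx i 0 : 'cV[R]_2) = 0.
  apply/matrixP => x y; rewrite !mxE (bigD1 i) //= !mxE ord1 !eqxx mulr1.
  rewrite big1 => [|l /negbTE li].
    by rewrite addr0; apply/eqP/contraT => hx; case: h; exists x.
  by rewrite !mxE li mulr0.
by rewrite !mxE !eqxx => /eqP; rewrite oner_eq0.
Qed.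

Lemma rank2_minor_neq0 : exists i j, minor2 i j != 0.
Proof.
apply: contrapT => h.
have m0 i j : minor2 i j = 0.
  by apply/eqP/contraT => hij; case: h; exists i, j.
have [j Aj] := rank2_row_neq0 0.
(* If all minors vanish, (g_j, -f_j) is killed by the transpose, though f_j is nonzero. *)
have /rank2_tr_inj /matrixP /(_ 1 0) :
    A^T *m (\col_i if i == 0 then A 1 j else - A 0 j) = 0.
  apply/matrixP => x y; rewrite !mxE big_ord_recl big_ord1 !mxE /=.
  have -> : lift ord0 ord0 = 1 :> 'I_2 by apply/val_inj.
  by rewrite -[RHS](m0 x j) /minor2; ring.
by rewrite !mxE /= => /eqP; rewrite oppr_eq0 (negbTE Aj).
Qed.

Lemma rank2_psi_neq0 : exists i j, br_psi A i j != 0.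
Proof.
apply: contrapT => h; have [x [y mxy]] := rank2_minor_neq0.
have p0 i j : br_psi A i j = 0.
  by apply/eqP/contraT => hij; case: h; exists i, j.
have := p0 (inord 2) (inord 3); have := p0 (inord 1) (inord 3); have := p0 (inord 1) (inord 2).
have := p0 (inord 0) (inord 3); have := p0 (inord 0) (inord 2); have := p0 (inord 0) (inord 1).
rewrite !br_psi2E !inordK //= => h1 /eqP; rewrite oppr_eq0 => /eqP h2 h3 h4 /eqP.
rewrite oppr_eq0 => /eqP h5 h6; move: mxy; apply/negP/negPn/eqP.
have sw a b : a - b = 0 -> b - a = 0 :> R by move=> ab; rewrite -opprB ab oppr0.
rewrite /minor2 -[x]inord_val -[y]inord_val; case: x => [[|[|[|[|//]]]] hx];
  case: y => [[|[|[|[|//]]]] hy] /=; rewrite ?subrr //; exact: sw.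
Qed.

End MinorIdeal.

Section Minimal.
Variables (k : fieldType) (n : nat).
Local Notation R := {mpoly k[n]}.

(** Negative target shifts put the entries of A in positive degree, and those of psi in degree minus
    the sum of the shifts, positive as m > 0. *)
Lemma buchsbaum_rim_minimal m (a : 'I_m -> int) (A : 'M[R]_(m, m.+2)) :
  (0 < m)%N -> graded_mx a (fun=> 0) A -> (forall i, a i < 0) ->
  minimal_complex (buchsbaum_rim a (fun=> 0) A).
Proof.
move=> m0 hA a0; have A0 i j : (A i j)@_0%MM = 0.
  by apply: homogz_gt0_coef0 (hA i j); rewrite sub0r oppr_gt0.
split=> i j /=; rewrite ?mxE //.
have := br_psi_graded hA i j; rewrite mxE; apply: homogz_gt0_coef0.
rewrite !subr0 big1 // sub0r -sumrN.
case: m m0 a A hA a0 {A0 i j} => // m _ a A _ a0.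
rewrite big_ord_recl /=; apply: ltr_wpDr; last by rewrite oppr_gt0.
by apply: sumr_ge0 => i _; rewrite oppr_ge0 ltW.
Qed.

End Minimal.

Section CodimThree.
Variables (k : fieldType) (hk : infinite_field k) (N : nat).
Local Notation n := N.+3.
Local Notation R := {mpoly k[n]}.
Local Notation H := (binp N.+2).
Variables (d1 d2 : nat) (Theta : 'M[R]_(2, 4)).
Hypotheses (hrank : mx_rank_frac Theta = 2%N)
  (hdeg : forall i j, Theta i j \is (row_deg d1 d2 i).-homog).
Local Notation Q := (gcoker (target_shift d1 d2) Theta).
Local Notation psi := (br_psi Theta).
Local Notation d := (d1 + d2)%N.

Let hT : graded_mx (target_shift d1 d2) (fun=> 0) Theta := graded_Theta hdeg.

Let deltaE : \sum_(j < 4) 0 - \sum_i target_shift d1 d2 i = d%:Z.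
Proof. by rewrite big1 // !big_ord_recl big_ord0 /target_shift /row_deg /=; lia. Qed.

Let hpsi : graded_mx (fun=> 0) (fun=> d%:Z) psi.
Proof. by have := br_psi_graded hT; rewrite deltaE subr0. Qed.

Let hTt : graded_mx (fun=> d%:Z) (fun i => d%:Z - target_shift d1 d2 i) Theta^T.
Proof.
move=> i j; rewrite mxE; have := hT j i; congr homogz; ring.
Qed.

(** The columns of psi are syzygies of degree d, and rank 2 makes one of them nonzero. *)
Lemma syz_indeg_le e : syz_indeg Theta e%:Z -> (e <= d)%N.
Proof.
move=> [_ hmin]; have [i [j pij]] := rank2_psi_neq0 hrank.
have : e%:Z <= d%:Z; last by [].
apply: (hmin _ (col j psi)).
  split; first by rewrite /syz colE mulmxA br2_complex1 mul0mx.
  by move=> l; rewrite mxE -[X in homogz X](_ : d%:Z - 0 = _) //; apply: hpsi.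
by apply: contraNneq pij => /matrixP /(_ i 0); rewrite !mxE => ->.
Qed.

Hypothesis hkd : krull_dim_le Q (n - 3).

Lemma minor_regular_triple : exists a b c : R,
  [/\ minor_ideal Theta a, minor_ideal Theta b, minor_ideal Theta c
    & regular_seq (fun x => x = 0) [:: a; b; c]].
Proof.
have [||//||s [ss sI _ sreg]] :=
    @homog_regular_seq k hk n 3 (minor_ideal Theta).
- exact: minor_ideal_ideal.
- by move=> t f; apply: minor_ideal_homog hdeg.
- apply: (krull_dim_chain hkd) => P hP JP x /gann_minor_ideal /JP.
  exact: prime_idealX.
case: s ss sI sreg => [|a [|b [|c []]]] //= _ sI sreg.
exists a, b, c; split=> //; apply: sI; rewrite !inE eqxx ?orbT //.
Qed.

Lemma buchsbaum_rim_exact :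
  (forall z : 'cV_4, Theta *m z = 0 -> exists u, z = psi *m u) /\
  (forall u : 'cV_4, psi *m u = 0 -> exists c, u = Theta^T *m c).
Proof.
have [a [b [c [ha hb hc habc]]]] := minor_regular_triple.
have kills := minor_ideal_sub (annihilates_homology_ideal Theta psi Theta^T)
  (br2_annihilates Theta).
apply: (regular_exact (br2_complex2 Theta) (rank2_tr_inj hrank) habc); exact: kills.
Qed.

Lemma buchsbaum_rim_resolution :
  graded_free_resolution Q (buchsbaum_rim (target_shift d1 d2) (fun=> 0) Theta).
Proof.
have [ex1 ex2] := buchsbaum_rim_exact; split.
- exact: buchsbaum_rim_graded.
- exists 1%:M; split.
  + move=> i j; rewrite mxE; case: eqVneq => [->|_]; last exact: (subspace_homogz _ _ _).1.
    by rewrite subrr; apply: dhomog1.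
  + by move=> w; exists w; rewrite mul1mx subrr; exists 0; rewrite mulmx0.
  + by move=> y; rewrite mul1mx.
- move=> z; split; first exact: ex1.
  by move=> [u ->]; rewrite mulmxA br2_complex1 mul0mx.
- move=> u; split; first exact: ex2.
  by move=> [c ->]; rewrite mulmxA br2_complex2 mul0mx.
- exact: rank2_tr_inj.
Qed.

Lemma syz_indeg_eq e : syz_indeg Theta e%:Z -> e = d.
Proof.
move=> he; apply/eqP; rewrite eqn_leq syz_indeg_le //= leqNgt; apply/negP => ed.
have [[v [Sv hv] v0] _] := he; have [u vu] := buchsbaum_rim_exact.1 v Sv.
(* By exactness v comes from elements of degree e - d of R^4, and these are 0 for e < d. *)
case/negP: v0; apply/eqP; rewrite -(hcomp_id hv) vu (hcomp_mul hpsi).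
suff -> : hcomp (fun=> d%:Z) e u = 0 by rewrite mulmx0.
apply/matrixP => i j; rewrite !mxE.
by case E : (e%:Z - d%:Z) => [x|x] //; lia.
Qed.

Lemma fdim_syz_codim3 (t : nat) i :
  fdim (fun v : 'cV[R]_4 => homog_vec (fun=> 0) t v /\ Theta *m v = 0) i ->
  (i + \sum_l hdim n (t%:Z - (d%:Z - target_shift d1 d2 l)) =
    4 * hdim n (t%:Z - d%:Z))%N.
Proof.
move=> hi; have [ex1 ex2] := buchsbaum_rim_exact.
have n0 : (0 < n)%N by [].
have [j hj] := fdim_ker (fun=> d%:Z) psi t n0.
have E1 : (\sum_(l < 4) hdim n (t%:Z - d%:Z) = j + i)%N.
  apply: (fdim_graded hpsi n0 hj).
  suff -> : (fun w => homog_vec (fun=> 0) t w /\ exists v, w = psi *m v) =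
      (fun v => homog_vec (fun=> 0) t v /\ Theta *m v = 0) by [].
  apply/funext => w; apply/propext; split=> [[hw [v vw]]|[hw /ex1 //]].
  by split=> //; rewrite vw mulmxA br2_complex1 mul0mx.
have E2 : (\sum_l hdim n (t%:Z - (d%:Z - target_shift d1 d2 l)) = 0 + j)%N.
  apply: (fdim_graded hTt n0).
    suff -> : (fun v => homog_vec (fun i => d%:Z - target_shift d1 d2 i) t v /\
       Theta^T *m v = 0) = (fun v => v = 0) by apply: fdim_zero.
    apply/funext => v; apply/propext; split=> [[_ /(rank2_tr_inj hrank)] //|->].
    by split; [apply: (subspace_homog_vec _ _ _ _).1 | rewrite mulmx0].
  suff -> : (fun w => homog_vec (fun=> d%:Z) t w /\ exists v, w = Theta^T *m v) =
      (fun v => homog_vec (fun=> d%:Z) t v /\ psi *m v = 0) by [].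
  apply/funext => w; apply/propext; split=> [[hw [v vw]]|[hw /ex2 //]].
  by split=> //; rewrite vw mulmxA br2_complex2 mul0mx.
by rewrite E2; move: E1; rewrite sum_nat_const card_ord; lia.
Qed.

(** Up to scale, e_0 and then e_1 are the signed sums of the shifts and of their squares in the
    resolution. Both vanish: d1 + d2 - 4d + (d + d1) + (d + d2) = 0 and d1^2 + d2^2 + 4d^2 - (d +
    d1)^2 - (d + d2)^2 = 0 for d = d1 + d2. *)
Lemma hilbert_coefs_codim3 HP e0 e1 :
  hilbert_poly Q HP -> hilbert_coefs n HP e0 e1 -> e0 = 0 /\ e1 = 0.
Proof.
move=> [t0 hQ].
have EHP : HP = shiftp d1%:R H + shiftp d2%:R H - 4 *: H
    + 4 *: shiftp (- d%:R) H - shiftp (- (d + d1)%:R) H - shiftp (- (d + d2)%:R) H.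
  apply: (@eventually_poly_eq _ _ (t0 + d + d1 + d2)) => t ht.
  have [|m hm ->] := hQ t; first by lia.
  have [i hi] := fdim_ker (fun=> 0) Theta t (ltn0Sn N.+2).
  have := fdim_syz_codim3 hi; move=> /(congr1 (fun x => x%:R : rat)); rewrite natrD natrM.
  rewrite !big_ord_recl big_ord0 /target_shift /row_deg /= !opprK addn0 natrD => Ei.
  rewrite (hilbert_fun_coker_syz hdeg hm hi).
  rewrite (@hdim_shiftE _ (- d%:Z) t (t%:Z - d%:Z)) // in Ei; last by lia.
  rewrite (@hdim_shiftE _ (- (d + d1)%N%:Z) t (t%:Z - (d%:Z + d1%:Z))) // in Ei; last by lia.
  rewrite (@hdim_shiftE _ (- (d + d2)%N%:Z) t (t%:Z - (d%:Z + d2%:Z))) // in Ei; last by lia.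
  rewrite !intrN -!pmulrn in Ei.
  rewrite !hornerD !hornerN !hornerZ; lra.
have [Hs H2 H1] := binp_coef N.
have T x := coef_shiftp_top x Hs.
have [_ a1 a0] := T d1%:R; have [_ b1 b0] := T d2%:R; have [_ c1 c0] := T (- d%:R).
have [_ x1 x0] := T (- (d + d1)%:R); have [_ y1 y0] := T (- (d + d2)%:R).
have f0 m : m`!%:R != 0 :> rat by rewrite pnatr_eq0 -lt0n fact_gt0.
rewrite /hilbert_coefs !subSS !subn0 EHP !coefD !coefN !(coefZ 4).
rewrite a1 b1 c1 x1 y1 a0 b0 c0 x0 y0 !(natrD _ d) !(natrD _ d1 d2).
move=> [E0 E1].
have e00 : e0 = 0.
  apply/eqP; have : e0 / N.+1`!%:R == 0 by rewrite -E0; apply/eqP; ring.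
  by rewrite mulf_eq0 invr_eq0 (negbTE (f0 _)) orbF.
split=> //; move: E1; rewrite e00 eqxx => E1.
apply/eqP; have : e1 / N`!%:R == 0 by rewrite -E1; apply/eqP; field.
by rewrite mulf_eq0 invr_eq0 (negbTE (f0 _)) orbF.
Qed.

End CodimThree.

(** * A constant first row *)

Section ConstantRow.
Variables (k : fieldType) (hk : infinite_field k) (N : nat).
Local Notation n := N.+3.
Local Notation R := {mpoly k[n]}.
Variables (d2 : nat) (d2_gt0 : (0 < d2)%N) (Theta : 'M[R]_(2, 4)).
Hypotheses (hrank : mx_rank_frac Theta = 2%N)
  (hdeg : forall i j, Theta i j \is (row_deg 0 d2 i).-homog).
Local Notation Q := (gcoker (target_shift 0 d2) Theta).
Hypothesis hkd : krull_dim_le Q (n - 3).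

(* Subtracting multiples of the constant row cancels R from the target of Theta,
   leaving Q = R(d2) / (g'_1, g'_2, g'_3), with the same ideal of maximal minors. *)
Lemma koszul_resolution :
  exists (a : 'I_1 -> int) (b : 'I_3 -> int) (A : 'M[R]_(1, 3)),
    minimal_graded_free_resolution Q (buchsbaum_rim a b A).
Proof.
have [j fj0] := rank2_row_neq0 hrank 0.
have [c fE] : exists c : 'I_4 -> k, forall i, Theta 0 i = (c i)%:MP.
  exists (fun i => (Theta 0 i)@_0%MM) => i; apply: homog0_const.
  by have := hdeg 0 i.
have cj0 : c j != 0 by apply: contraNneq fj0 => cj; rewrite fE cj.
pose ci := ((c j)^-1)%:MP : R.
have fci : Theta 0 j * ci = 1 by rewrite fE -mpolyCM divff.
(* The second row after column operations that clear the first row outside column j. *)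
pose g' i := Theta 1 i - ci * Theta 0 i * Theta 1 j.
have g'j : g' j = 0 by rewrite /g' [ci * _]mulrC fci mul1r subrr.
pose A : 'M[R]_(1, 3) := \row_l g' (lift j l).
pose a (_ : 'I_1) : int := - d2%:Z.
have g'h i : g' i \is d2.-homog.
  have h1 l : Theta 1 l \is d2.-homog := hdeg 1 l.
  by rewrite /g' fE -mpolyCM mul_mpolyC rpredB // rpredZ.
have hA : graded_mx a (fun=> 0) A.
  by move=> x l; rewrite mxE /a opprK add0r; apply: g'h.
(* So the minors of Theta lie in the ideal of the g', whose elements annihilate the Koszul
   homology. *)
have minorE x y : minor2 Theta x y = Theta 0 x * g' y - Theta 0 y * g' x.
  by rewrite /minor2 /g'; ring.
have [u [v [w [hu hv hw uvw]]]] := minor_regular_triple hk hdeg hkd.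
have hI := annihilates_homology_ideal A (br_psi A) A^T.
have kills : forall x, minor_ideal Theta x ->
    annihilates_homology A (br_psi A) A^T x.
  apply: minor_ideal_sub => // x y; rewrite minorE.
  have kg z : annihilates_homology A (br_psi A) A^T (g' z).
    case: (unliftP j z) => [l ->|->]; last by rewrite g'j; apply: ideal0.
    by have := br1_annihilates A l; rewrite mxE.
  by apply: (idealB hI); apply: (idealM hI).
have Ainj (z : 'cV[R]_1) : A^T *m z = 0 -> z = 0.
  (* If A were 0, all minors of Theta and hence u would be 0, against regularity. *)
  have [l Al] : exists l, A 0 l != 0.
    apply: contrapT => h; case: (uvw) => hu0 _.
    apply: (elimN eqP (oner_neq0 R)); apply: hu0; rewrite mulr1.
    apply: (minor_ideal_sub (zero_prime R) _ hu) => x y.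
    have g0 z' : g' z' = 0.
      case: (unliftP j z') => [l ->|->] //; apply/eqP/contraT => hl.
      by case: h; exists l; rewrite mxE.
    by rewrite minorE !g0 !mulr0 subrr.
  move=> /matrixP /(_ l 0); rewrite !mxE big_ord1 !mxE => /eqP.
  rewrite mxE in Al; rewrite mulf_eq0 (negbTE Al) => /eqP z0.
  by apply/matrixP => x y; rewrite !ord1 z0 mxE.
have [ex1 ex2] :=
  regular_exact (br1_complex2 A) Ainj uvw (kills _ hu) (kills _ hv) (kills _ hw).
have one_lift : lift ord0 ord0 = 1 :> 'I_2 by apply/val_inj.
have sum4 (F : 'I_4 -> R) : \sum_x F x = F j + \sum_l F (lift j l) by rewrite (bigD1_ord j).
exists a, (fun=> 0), A; split; last first.
  by apply: buchsbaum_rim_minimal => // i; rewrite /a oppr_lt0.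
split; first exact: buchsbaum_rim_graded.
- exists (\matrix_(i, _) if i == 1 then 1 else 0); split.
  + move=> x y; rewrite mxE /= /a /target_shift /row_deg.
    have [->|->] : x = 0 \/ x = 1 by case: x => [[|[|//]] hx]; [left|right]; apply/val_inj.
      by apply/homogzE; rewrite raddf0.
    by rewrite /= opprK addNr; apply: dhomog1.
  (* Column j of Theta times ci * z 0 0 has first coordinate z 0 0; what is left of z lies in the
     summand R(d2). *)
  + move=> z; exists (const_mx (z 1 0 - ci * z 0 0 * Theta 1 j)).
    exists (\col_x if x == j then ci * z 0 0 else 0).
    apply/matrixP => x y; rewrite ord1 !mxE big_ord1 !mxE.
    rewrite sum4 !mxE eqxx big1 ?addr0 => [|l _]; last first.
      by rewrite mxE eq_sym (negbTE (neq_lift _ _)) mulr0.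
    have [->|->] : x = 0 \/ x = 1 by case: x => [[|[|//]] hx]; [left|right]; apply/val_inj.
      by rewrite /= mul0r subr0 mulrA fci mul1r.
    by rewrite /=; ring.
  + move=> y; split=> [[z /matrixP E]|[z yE]].
      have := E 0 0; have := E 1 0; rewrite !mxE !big_ord1 !mxE /= mul1r mul0r.
      rewrite !sum4 => y0 f0; exists (\col_l z (lift j l) 0).
      apply/matrixP => x x'; rewrite !ord1 y0 mxE.
      under [RHS]eq_bigr => l _ do rewrite !mxE /g' mulrBl -!mulrA.
      rewrite sumrB -!mulr_sumr.
      have -> : \sum_l Theta 0 (lift j l) * (Theta 1 j * z (lift j l) 0) =
          Theta 1 j * (- (Theta 0 j * z j 0)).
        have -> : - (Theta 0 j * z j 0) = \sum_l Theta 0 (lift j l) * z (lift j l) 0.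
          by apply/eqP; rewrite eq_sym -addr_eq0 addrC -f0.
        by rewrite mulr_sumr; apply: eq_bigr => l _; ring.
      rewrite addrC; congr (_ + _).
      have -> : ci * (Theta 1 j * - (Theta 0 j * z j 0)) =
          - (Theta 0 j * ci) * (Theta 1 j * z j 0) by ring.
      by rewrite fci mulN1r opprK.
    pose s := \sum_l Theta 0 (lift j l) * z l 0.
    (* The j-th coordinate is chosen to cancel the first row. *)
    exists (\col_x if unlift j x is Some l then z l 0 else - (ci * s)).
    apply/matrixP => x x'; rewrite ord1 !mxE big_ord1 !mxE sum4 !mxE unlift_none.
    under eq_bigr => l _ do rewrite mxE liftK.
    have [->|->] : x = 0 \/ x = 1 by case: x => [[|[|//]] hx]; [left|right]; apply/val_inj.
      by rewrite /= mul0r -/s mulrN mulrA fci mul1r addNr.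
    rewrite /= mul1r yE mxE.
    under [LHS]eq_bigr => l _ do rewrite !mxE /g' mulrBl.
    rewrite sumrB addrC; congr (_ + _).
    have -> : Theta 1 j * - (ci * s) =
        - (\sum_l ci * Theta 1 j * (Theta 0 (lift j l) * z l 0)).
      by rewrite -mulr_sumr -/s; ring.
    by congr (- _); apply: eq_bigr => l _; ring.
- move=> z; split; first exact: ex1.
  by move=> [t ->]; rewrite mulmxA br1_complex1 mul0mx.
- move=> t; split; first exact: ex2.
  by move=> [z ->]; rewrite mulmxA br1_complex2 mul0mx.
- exact: Ainj.
Qed.

End ConstantRow.

Theorem theorem1 (k : fieldType) (n : nat) (hk : infinite_field k) (hn : (3 <= n)%N)
    (d1 d2 : nat) (hd : (d1 <= d2)%N)
    (Theta : 'M[{mpoly k[n]}]_(2, 4))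
    (hrank : mx_rank_frac Theta = 2%N)
    (hdeg : forall i j, Theta i j \is (row_deg d1 d2 i).-homog)
    (hgcd : forall i, row_gcd1 Theta i)
    (e : nat) (he : syz_indeg Theta e) (he1 : (1 <= e)%N)
    (nu : 'cV[{mpoly k[n]}]_4) (hnu : syz_min_gen Theta e nu)
    (hfree : ~ syz_free Theta)
    (HP : {poly rat}) (e0 e1 : rat)
    (hHP : hilbert_poly (gcoker (target_shift d1 d2) Theta) HP)
    (hcoefs : hilbert_coefs n HP e0 e1) :
  let Q := gcoker (target_shift d1 d2) Theta in
  let d : rat := (d1 + d2)%:R in
  let q : rat := (d1 ^ 2 + d2 ^ 2 + d1 * d2)%:R in
  let l : rat := (e0 ^+ 2 + e0) / 2 in
  (forall b : rat, bourbaki_degree Theta b ->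
     b = if e0 != 0 then (e%:R - d) * (e%:R + e0) + q + l + e1
         else e%:R * (e%:R - d) + q - e1) /\
  (krull_dim_le Q (n - 3) ->
     (forall b : rat, bourbaki_degree Theta b -> b = q) /\
     let BR := buchsbaum_rim (target_shift d1 d2) (fun _ => 0) Theta in
     [/\ graded_free_resolution Q BR,
         (0 < d1)%N -> minimal_graded_free_resolution Q BR
       & exists m (a : 'I_m -> int) (b : 'I_m.+2 -> int)
           (A : 'M[{mpoly k[n]}]_(m, m.+2)),
           minimal_graded_free_resolution Q (buchsbaum_rim a b A)]).
Proof.
case: n hn => [|[|[|N]]] // _ in Theta hrank hdeg hgcd he nu hnu hfree hHP hcoefs *.
move=> Q d q l.
have formula b : bourbaki_degree Theta b ->
     b = if e0 != 0 then (e%:R - d) * (e%:R + e0) + q + l + e1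
         else e%:R * (e%:R - d) + q - e1.
  exact: (bourbaki_degree_formula hk hdeg he hfree hHP hcoefs).
split=> // hkd; have ed := syz_indeg_eq hk hrank hdeg hkd he.
split.
  move=> b /formula ->; have [-> ->] := hilbert_coefs_codim3 hk hrank hdeg hkd hHP hcoefs.
  by rewrite eqxx /= ed subrr mulr0 add0r subr0.
have res := buchsbaum_rim_resolution hk hrank hdeg hkd.
have min : (0 < d1)%N -> minimal_graded_free_resolution Q
    (buchsbaum_rim (target_shift d1 d2) (fun=> 0) Theta).
  move=> d1_gt0; split=> //; apply: buchsbaum_rim_minimal => //; first exact: graded_Theta.
  move=> i; rewrite /target_shift oppr_lt0 /row_deg; case: ifP => _; lia.
split=> //; case: (posnP d1) => [d10|/min h]; last first.
  by exists 2%N, (target_shift d1 d2), (fun=> 0), Theta.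
(* Here e = d = d2, so e >= 1 gives d2 > 0, and the Koszul complex is minimal. *)
subst d1; have d2_gt0 : (0 < d2)%N by rewrite -[d2]add0n -ed.
have [a [b [A hA]]] := koszul_resolution hk d2_gt0 hrank hdeg hkd.
by exists 1%N, a, b, A.
Qed.
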